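(* Let $d\ge1$ be an integer, $n_k=\binom{d}{k}-1$ for $k=0,\dots,d$, and let $l:\mathcal{D}_d\to[0,\infty)$ be $l(p)=\prod_{k=0}^d\frac{p_k^{n_k}}{n_k!}$. Then the density $l$, normalized over the simplex $\mathcal{D}_d$, is the density of the Dirichlet distribution on $\mathcal{D}_d$ with parameters $\alpha_k=\binom{d}{k}$, $k=0,\dots,d$; that is, the probability measure on $\mathcal{D}_d$ whose density with respect to the Hausdorff measure $\mathcal{H}^d$ on $\mathcal{D}_d$ is proportional to $l$ is the distribution $\mathrm{Dirichlet}\left(\binom{d}{0},\dots,\binom{d}{d}\right)$.
   Context: $\mathcal{D}_d=\{p=(p_0,\dots,p_d)\in\mathbb{R}^{d+1}: p_k\ge0,\ \sum_{k=0}^dp_k=1\}$ is the simplex of probability mass functions on $\{0,\dots,d\}$. $\mathrm{Dirichlet}(\alpha_0,\dots,\alpha_d)$, $\alpha_k>0$, is the probability distribution on $\mathcal{D}_d$ whose density in the coordinates $(p_0,\dots,p_{d-1})$ (with $p_d=1-\sum_{k<d}p_k$) with respect to $dp_0\cdots dp_{d-1}$ is $\frac{\Gamma(\sum_k\alpha_k)}{\prod_k\Gamma(\alpha_k)}\prod_{k=0}^dp_k^{\alpha_k-1}$. Convention: $0^0=1$. *)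

(* Defs.v *)
From HB Require Import structures.
From mathcomp Require Import all_boot all_order all_algebra.
From mathcomp Require Import all_classical all_reals all_analysis.

Set Implicit Arguments.
Unset Strict Implicit.
Unset Printing Implicit Defensive.

Import Order.TTheory GRing.Theory Num.Theory.
Import numFieldNormedType.Exports.

Local Open Scope classical_set_scope.
Local Open Scope ring_scope.

(* Points of R^n are n.-tuple R; the library equips this type with the product
   sigma-algebra of the Borel sets of R, i.e. the Borel sets of R^n. *)

Section euclidean_hausdorff.
Context {R : realType} {n : nat}.
Implicit Types (x y : n.-tuple R) (A U : set (n.-tuple R)).

Definition edist x y : R :=
  Num.sqrt (\sum_(i < n) (tnth x i - tnth y i) ^+ 2).

Local Open Scope ereal_scope.

(* The maximum with 0 only matters for the empty set, whose diameter is 0. *)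
Definition diam A : \bar R :=
  maxe 0 (ereal_sup [set (edist x y)%:E | x in A & y in A]).

(* The empty set has weight 0 even when s = 0. *)
Definition hweight (s : nat) U : \bar R :=
  if U == set0 then 0 else diam U ^+ s.

Definition delta_cover (delta : R) A : set ((set (n.-tuple R))^nat) :=
  [set U | A `<=` \bigcup_k U k /\ forall k, diam (U k) <= delta%:E].

Definition hausdorff_delta (s : nat) (delta : R) A : \bar R :=
  ereal_inf [set \sum_(k <oo) hweight s (U k) | U in delta_cover delta A].

(* The s-dimensional Hausdorff outer measure, as the supremum (equivalently the
   limit as delta -> 0) of the delta-contents.  It is not multiplied by the
   volume factor omega_s / 2 ^ s which some authors include. *)
Definition hausdorff (s : nat) A : \bar R :=
  ereal_sup [set hausdorff_delta s delta A | delta in [set delta | (0 < delta)%R]].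

Lemma hweight_ge0 s U : 0 <= hweight s U.
Proof.
rewrite /hweight; case: ifPn => // _.
by apply: expe_ge0; rewrite /diam le_max lexx.
Qed.

Lemma hausdorff_delta_ge0 s delta A : 0 <= hausdorff_delta s delta A.
Proof.
apply: le_ereal_inf_tmp => _ [U _ <-].
by apply: nneseries_ge0 => k _ _; exact: hweight_ge0.
Qed.

Lemma diam0 : diam set0 = 0.
Proof.
rewrite /diam (_ : [set _ | _ in _ & _ in _] = set0) ?ereal_sup0.
  by apply/max_idPl; rewrite leNye.
by rewrite -subset0 => _ [x []].
Qed.

End euclidean_hausdorff.

Section hausdorff_outer_measure.
Context {R : realType} (n s : nat).
Local Open Scope ereal_scope.

Let hausdorff0 : @hausdorff R n s set0 = 0.
Proof.
apply/eqP; rewrite eq_le; apply/andP; split.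
  apply: ge_ereal_sup => _ [e /= e0 <-].
  apply: ereal_inf_lbound; exists (fun=> set0).
    by split=> // k; rewrite diam0 lee_fin ltW.
  by rewrite eseries0// => k _ _; rewrite /hweight eqxx.
apply: (le_trans (hausdorff_delta_ge0 s 1 set0)).
by apply: ereal_sup_ubound; exists 1%R => /=.
Qed.

Let hausdorff_ge0 A : 0 <= @hausdorff R n s A.
Proof.
apply: (le_trans (hausdorff_delta_ge0 s 1 A)).
by apply: ereal_sup_ubound; exists 1%R => /=.
Qed.

Let le_hausdorff : {homo @hausdorff R n s : A B / A `<=` B >-> A <= B}.
Proof.
move=> A B AB; apply: ge_ereal_sup => _ [e /= e0 <-].
apply: le_trans; last by apply: ereal_sup_ubound; exists e.
apply: ereal_inf_le_tmp => _ [U [BU dU] <-].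
by exists U => //; split => //; exact: subset_trans BU.
Qed.

Let hausdorff_delta_subadditive (delta : R) (A : (set (n.-tuple R))^nat) :
  hausdorff_delta s delta (\bigcup_k A k) <=
  \sum_(k <oo) hausdorff_delta s delta (A k).
Proof.
have [[i ioo]|] := pselect (exists i, hausdorff_delta s delta (A i) = +oo).
  rewrite (eseries_pinfty _ _ ioo) ?leey// => k _.
  by rewrite -ltNye (lt_le_trans _ (hausdorff_delta_ge0 _ _ _)).
rewrite -forallNE => Aoo.
suff add2e (e : {posnum R}) : hausdorff_delta s delta (\bigcup_k A k) <=
    \sum_(i <oo) hausdorff_delta s delta (A i) + e%:num%:E.
  by apply/lee_addgt0Pr => _/posnumP[].
rewrite (le_trans _ (epsilon_trick _ _ _))//; last first.
  by move=> k; exact: hausdorff_delta_ge0.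
pose P k (B : (set (n.-tuple R))^nat) := delta_cover delta (A k) B /\
  \sum_(j <oo) hweight s (B j) <=
  hausdorff_delta s delta (A k) + (e%:num / (2 ^ k.+1)%:R)%:E.
have [G PG] : {G : ((set (n.-tuple R))^nat)^nat & forall k, P k (G k)}.
  apply: (@choice _ _ P) => k; rewrite /P /hausdorff_delta.
  set S := (X in ereal_inf X); move infS : (ereal_inf S) => iS.
  case: iS infS => [r Sr|Soo|Soo].
  - have en1 : (0 < e%:num / (2 ^ k.+1)%:R)%R by [].
    have /(lb_ereal_inf_adherent en1) : ereal_inf S \is a fin_num by rewrite Sr.
    move=> [x [B AB muBx] xS].
    by exists B; split => //; rewrite muBx -Sr; exact/ltW.
  - by have := Aoo k; rewrite /hausdorff_delta Soo.
  - by have := hausdorff_delta_ge0 s delta (A k); rewrite /hausdorff_delta Soo.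
pose w x := hweight s (uncurry G x).
have w_ge0 x : 0 <= w x by exact: hweight_ge0.
apply: (@le_trans _ _ (\esum_(i in setT) w i)).
  apply: ereal_inf_lbound => /=.
  have /card_esym/ppcard_eqP[f] := card_nat2.
  exists (uncurry G \o f).
    split => [|i]; last by rewrite /=; case: (f i) => a b; exact: (PG a).1.2.
    move=> t [i _ /(PG i).1.1 [j _ Gt]].
    by exists (f^-1%FUN (i, j)) => //=; rewrite invK ?inE.
  rewrite -(esum_pred_image w _ xpredT) ?[fun=> _]set_true//.
  by rewrite image_eq.
rewrite (_ : esum _ _ = \sum_(i <oo) \sum_(j <oo) hweight s (G i j)); last first.
  pose J : nat -> set (nat * nat) := fun i => [set (i, j) | j in setT].
  rewrite (_ : setT = \bigcup_k J k); last first.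
    by rewrite predeqE => -[a b]; split => // _; exists a => //; exists b.
  rewrite esum_bigcupT //=; last first.
    apply/trivIsetP => i j _ _ ij.
    rewrite predeqE => -[a b] /=; split => //= -[] [_] _ [<-{a} _].
    by move=> [m' _] [] /esym/eqP; rewrite (negbTE ij).
  rewrite -(image_id [set: nat]) -fun_true esum_pred_image//; last first.
    by move=> k _; exact: esum_ge0.
  apply: eq_eseriesr => /= j _.
  rewrite -(esum_pred_image w (pair j) predT)//=; last first.
    by move=> ? ? _ _; exact: (@can_inj _ _ _ snd).
  by congr esum; rewrite predeqE => -[a b]; split; move=> [i _ <-]; exists i.
apply: lee_nneseries => [i _ _|i _]; last exact: (PG i).2.
by apply: nneseries_ge0 => j _ _; exact: hweight_ge0.
Qed.

Let hausdorff_subadditive : sigma_subadditive (@hausdorff R n s).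
Proof.
move=> A; apply: ge_ereal_sup => _ [e /= e0 <-].
apply: (le_trans (hausdorff_delta_subadditive e A)).
apply: lee_nneseries => [i _ _|i _]; first exact: hausdorff_delta_ge0.
by apply: ereal_sup_ubound; exists e.
Qed.

HB.instance Definition _ := isOuterMeasure.Build R (n.-tuple R)
  (@hausdorff R n s) hausdorff0 hausdorff_ge0 le_hausdorff
  hausdorff_subadditive.

End hausdorff_outer_measure.

Section lebesgue_tuple.
Context {R : realType}.
Local Open Scope ereal_scope.

Definition tcons n (z : measurableTypeR R * n.-tuple R) : n.+1.-tuple R :=
  [tuple of z.1 :: z.2].

Lemma measurable_tcons n : measurable_fun setT (@tcons n).
Proof. exact: measurable_cons. Qed.

End lebesgue_tuple.

Section lebesgue_tupleS.
Context {R : realType} (n : nat).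
Variable mu : {sigma_finite_measure set (n.-tuple R) -> \bar R}.
Local Open Scope ereal_scope.

Definition lebesgue_tupleS : set (n.+1.-tuple R) -> \bar R :=
  pushforward (@lebesgue_measure R \x mu) (@tcons R n).

Let lebesgue_tupleS0 : lebesgue_tupleS set0 = 0.
Proof. by rewrite /lebesgue_tupleS /pushforward preimage_set0 measure0. Qed.

Let lebesgue_tupleS_ge0 A : 0 <= lebesgue_tupleS A.
Proof. by rewrite /lebesgue_tupleS /pushforward; exact: integral_ge0. Qed.

Let lebesgue_tupleS_sigma_additive : semi_sigma_additive lebesgue_tupleS.
Proof.
move=> F mF tF mUF; rewrite /lebesgue_tupleS /pushforward preimage_bigcup.
apply: measure_semi_sigma_additive.
- by move=> i; rewrite -[X in measurable X]setTI; exact: measurable_tcons.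
- apply/trivIsetP => /= i j _ _ ij; rewrite -preimage_setI.
  by move/trivIsetP : tF => /(_ _ _ _ _ ij) ->//; rewrite preimage_set0.
- by rewrite -preimage_bigcup -[X in measurable X]setTI; exact: measurable_tcons.
Qed.

HB.instance Definition _ := isMeasure.Build _ _ _ lebesgue_tupleS
  lebesgue_tupleS0 lebesgue_tupleS_ge0 lebesgue_tupleS_sigma_additive.

Let lebesgue_tupleS_sigma_finite : sigma_finite setT lebesgue_tupleS.
Proof.
have /sigma_finiteP[F [TF ndF Foo]] := sigma_finiteT (@lebesgue_measure R).
have /sigma_finiteP[G [TG ndG Goo]] := sigma_finiteT mu.
pose g (t : n.+1.-tuple R) : measurableTypeR R * n.-tuple R :=
  (thead t, [tuple of behead t]).
have mg : measurable_fun setT g.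
  apply/measurable_fun_pair; first exact: measurable_tnth.
  exact: measurable_behead.
have tconsK : cancel (@tcons R n) g.
  by case=> x t; rewrite /g theadE; congr (_, _); exact: val_inj.
exists (fun k => g @^-1` (F k `*` G k)).
  rewrite -preimage_bigcup (_ : \bigcup_k _ = setT) ?preimage_setT//.
  rewrite -subTset => -[x t] _.
  have [i _ Fx] : (\bigcup_k F k) x by rewrite -TF.
  have [j _ Gt] : (\bigcup_k G k) t by rewrite -TG.
  exists (maxn i j) => //; split=> /=.
  - by move: x Fx; exact/subsetPset/ndF/leq_maxl.
  - by move: t Gt; exact/subsetPset/ndG/leq_maxr.
move=> k; have [mF Fk] := Foo k; have [mG Gk] := Goo k; split.
  by rewrite -[X in measurable X]setTI; apply: mg => //; exact: measurableX.
rewrite /lebesgue_tupleS /pushforward -comp_preimage.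
rewrite (_ : g \o _ = id); last exact/funext.
by rewrite preimage_id product_measure1E// lte_mul_pinfty// ge0_fin_numE.
Qed.

HB.instance Definition _ := Measure_isSigmaFinite.Build _ _ _ lebesgue_tupleS
  lebesgue_tupleS_sigma_finite.

End lebesgue_tupleS.

(* Lebesgue measure on R^n, as the n-fold product of lebesgue_measure. *)
Fixpoint lebesgue_tuple (R : realType) (n : nat) :
    {sigma_finite_measure set (n.-tuple R) -> \bar R} :=
  if n is m.+1 then lebesgue_tupleS (lebesgue_tuple R m)
  else @dirac _ (0.-tuple R) [tuple] R.

Section dirichlet.
Context {R : realType}.

(* The Gamma function at a > 0. *)
Definition Gamma (a : R) : R :=
  \int[lebesgue_measure]_(x in `]0, +oo[) (x `^ (a - 1) * expR (- x)).

Definition simplex (d : nat) : set (d.+1.-tuple R) :=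
  [set p | (forall k, 0 <= tnth p k) /\ \sum_(k < d.+1) tnth p k = 1].
Arguments simplex d _ : clear implicits.

(* (p_0, ..., p_(d-1)) |-> (p_0, ..., p_(d-1), 1 - \sum_(k < d) p_k) *)
Definition simplex_chart (d : nat) (x : d.-tuple R) : d.+1.-tuple R :=
  [tuple of rcons x (1 - \sum_(k < d) tnth x k)].

Definition dirichlet_pdf (d : nat) (alpha : 'I_d.+1 -> R) (p : d.+1.-tuple R)
    : R :=
  Gamma (\sum_k alpha k) / (\prod_k Gamma (alpha k)) *
  \prod_k (tnth p k `^ (alpha k - 1)).

(* P is Dirichlet(alpha), as a Borel probability on R^(d+1) carried by the
   simplex. *)
Definition is_dirichlet (d : nat) (alpha : 'I_d.+1 -> R)
    (P : probability (d.+1.-tuple R) R) : Prop :=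
  forall A, measurable A ->
    P A = (\int[lebesgue_tuple R d]_(x in
               [set x : d.-tuple R | (simplex d `&` A) (simplex_chart x)])
             (dirichlet_pdf alpha (simplex_chart x))%:E)%E.

(* P is carried by D and has there a density with respect to mu which is
   proportional to f. *)
Definition has_density_proportional_to (n : nat)
    (mu : set (n.-tuple R) -> \bar R) (D : set (n.-tuple R))
    (f : n.-tuple R -> R) (P : probability (n.-tuple R) R) : Prop :=
  exists2 c : R, 0 < c & forall A, measurable A ->
    P A = (\int[mu]_(p in D `&` A) (c * f p)%:E)%E.

Definition nexp (d k : nat) : nat := ('C(d, k) - 1)%N.

Definition ldens (d : nat) (p : d.+1.-tuple R) : R :=
  \prod_(k < d.+1) (tnth p k ^+ nexp d k / (nexp d k)`!%:R).

End dirichlet.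

Arguments simplex : clear implicits.

(* Main.v *)
(** The chart x |-> (x, 1 - sum x) identifies R^d with the hyperplane
    containing the simplex. The Hausdorff measure H^d is a metric outer measure,
    hence a measure on Borel sets; it is invariant under translations along the
    hyperplane, finite on images of cubes (subdivide them into m^d cubes), and
    bounded below by a multiple of Lebesgue measure (enclose each set of a cover
    in a cube). So its pull-back by the chart is K times Lebesgue measure on
    R^d, with 0 < K < +oo, and densities with respect to H^d become densities
    with respect to Lebesgue measure up to a constant. As alpha_k - 1 = n_k,
    both densities are multiples of prod_k p_k^(n_k); that they normalize to
    the same probability follows from the value prod_k (n_k)! / (sum_k alpha_k - 1)!
    of the Dirichlet integral, obtained by integrating out one coordinate at a
    time with the Beta integral. *)
Require Import Defs.
From HB Require Import structures.
From mathcomp Require Import all_boot all_order all_algebra.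
From mathcomp Require Import all_classical all_reals all_analysis.
From mathcomp Require Import measurable_realfun ring lra.
Import Defs.

Set Implicit Arguments.
Unset Strict Implicit.
Unset Printing Implicit Defensive.

Import Order.TTheory GRing.Theory Num.Theory.
Import numFieldNormedType.Exports.

Local Open Scope classical_set_scope.
Local Open Scope ring_scope.

(** * Hausdorff measures are Borel measures *)

Section hausdorff_theory.
Context {R : realType}.
Local Open Scope ereal_scope.

Lemma lee_expe2r s (x y : \bar R) : 0 <= x -> x <= y -> x ^+ s <= y ^+ s.
Proof.
move=> x0 xy; elim: s => [//|s ih]; rewrite !expeS.
by apply: lee_pmul => //; exact: expe_ge0.
Qed.

Lemma coord_le_edist n (x y : n.-tuple R) i :
  (`|tnth x i - tnth y i| <= edist x y)%R.
Proof.
rewrite -sqrtr_sqr /edist ler_wsqrtr// (bigD1 i)//= lerDl.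
by apply: sumr_ge0 => j _; exact: sqr_ge0.
Qed.

Lemma edist_le_diam n (A : set (n.-tuple R)) x y :
  A x -> A y -> (edist x y)%:E <= diam A.
Proof.
move=> Ax Ay; rewrite /diam le_max; apply/orP; right.
by apply: ereal_sup_ubound; exists x => //; exists y.
Qed.

Lemma diam_le n (A : set (n.-tuple R)) r : 0 <= r ->
  (forall x y, A x -> A y -> (edist x y)%:E <= r) -> diam A <= r.
Proof.
move=> r0 Ar; rewrite /diam ge_max r0/=.
by apply: ge_ereal_sup => _ [x Ax [y Ay <-]]; exact: Ar.
Qed.

Lemma diam_ge0 n (A : set (n.-tuple R)) : 0 <= diam A.
Proof. by rewrite /diam le_max lexx. Qed.

Lemma hweight_set0 n s : hweight s (@set0 (n.-tuple R)) = 0.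
Proof. by rewrite /hweight eqxx. Qed.

Lemma hausdorff_delta_decr n s (A : set (n.-tuple R)) (d1 d2 : R) :
  (d1 <= d2)%R -> hausdorff_delta s d2 A <= hausdorff_delta s d1 A.
Proof.
move=> d12; apply: ereal_inf_le_tmp => _ [U [AU dU] <-].
exists U => //; split => // k; apply: le_trans (dU k) _.
by rewrite lee_fin.
Qed.

Lemma hausdorff_delta_le n s (A : set (n.-tuple R)) (d : R) :
  (0 < d)%R -> hausdorff_delta s d A <= hausdorff s A.
Proof. by move=> d0; apply: ereal_sup_ubound; exists d. Qed.

Section contraction.
Context {n m : nat} (f : n.-tuple R -> m.-tuple R).
Hypothesis f1 : forall x y, (edist (f x) (f y) <= edist x y)%R.

Lemma diam_image_le A : diam (f @` A) <= diam A.
Proof.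
apply: diam_le; first exact: diam_ge0.
move=> _ _ [x Ax <-] [y Ay <-]; apply: le_trans (edist_le_diam Ax Ay).
by rewrite lee_fin.
Qed.

Lemma hausdorff_image_le s A : hausdorff s (f @` A) <= hausdorff s A.
Proof.
apply: ge_ereal_sup => _ [e /= e0 <-].
apply: le_trans (hausdorff_delta_le _ _ e0).
apply: le_ereal_inf_tmp => _ [U [AU dU] <-].
apply: ge_ereal_inf; exists (\sum_(k <oo) hweight s (f @` U k)).
  exists (fun k => f @` U k) => //; split=> [_ [x /AU [k _ Ukx] <-]|k].
    by exists k => //; exists x.
  exact: le_trans (diam_image_le _) _.
apply: lee_nneseries => k _; first by move=> _; exact: hweight_ge0.
(* The convention on the empty set is respected, since a set and its image are empty together. *)
rewrite /hweight; have [->|U0] := eqVneq (U k) set0; first by rewrite image_set0 eqxx.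
rewrite ifF; last by apply: contra_neqF U0 => /eqP /image_set0_set0.
by apply: lee_expe2r; [exact: diam_ge0|exact: diam_image_le].
Qed.

End contraction.

(** Both [f] and its left inverse [g] are contractions, so [hausdorff_image_le] applies in each
    direction. *)
Lemma hausdorff_bij n s (f g : n.-tuple R -> n.-tuple R) (A : set (n.-tuple R)) :
  cancel f g -> (forall x y, edist (f x) (f y) = edist x y) ->
  (forall x y, edist (g x) (g y) = edist x y) ->
  hausdorff s (f @` A) = hausdorff s A.
Proof.
move=> fK fi gi; apply/eqP; rewrite eq_le hausdorff_image_le ?andTb; last first.
  by move=> x y; rewrite fi.
rewrite -[A in X in X <= _](_ : g @` (f @` A) = A).
  by apply: hausdorff_image_le => x y; rewrite gi.
by rewrite image_comp (_ : g \o f = id) ?image_id//; exact/funext.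
Qed.

(** A set of diameter less than [b - a] cannot meet both [A] and [B], so a fine cover of the union
    splits into a cover of [A] and a cover of [B] that share no nonempty set. *)
Lemma hausdorffU_separated n s (A B : set (n.-tuple R)) i (a b : R) : (a < b)%R ->
  (forall x, A x -> tnth x i <= a)%R -> (forall x, B x -> b <= tnth x i)%R ->
  hausdorff s A + hausdorff s B <= hausdorff s (A `|` B).
Proof.
move=> ab Aa bB.
have key (e : R) : (0 < e)%R -> (e < b - a)%R ->
    hausdorff_delta s e A + hausdorff_delta s e B <= hausdorff_delta s e (A `|` B).
  move=> e0 eab; apply: le_ereal_inf_tmp => _ [U [ABU dU] <-].
  (* [V C] keeps the sets of the cover that meet [C] and replaces the others by the empty set, of
     weight 0. *)
  pose V (C : set (n.-tuple R)) k := if pselect (U k `&` C !=set0) then U k else set0.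
  have VC (C : set (n.-tuple R)) : C `<=` A `|` B ->
      hausdorff_delta s e C <= \sum_(k <oo) hweight s (V C k).
    move=> CAB; apply: ereal_inf_lbound; exists (V C) => //; split.
      move=> x Cx; have [k _ Ukx] := ABU _ (CAB _ Cx); exists k => //.
      by rewrite /V; case: pselect => [//|] []; exists x.
    by move=> k; rewrite /V; case: pselect => ?; [exact: dU|rewrite diam0 lee_fin ltW].
  apply: le_trans (leeD (VC A (@subsetUl _ _ _)) (VC B (@subsetUr _ _ _))) _.
  rewrite -nneseriesD; try by move=> k _ _; exact: hweight_ge0.
  apply: lee_nneseries => [k _ _|k _]; first by rewrite adde_ge0 ?hweight_ge0.
  rewrite /V; case: pselect => [xA|?]; last first.
    by rewrite hweight_set0 add0e; case: pselect => ?; rewrite ?hweight_set0 ?hweight_ge0.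
  case: pselect => [yB|?]; last by rewrite hweight_set0 adde0.
  have [x [Ux Ax]] := xA; have [y [Uy By]] := yB.
  exfalso; have := le_trans (edist_le_diam Ux Uy) (dU k); rewrite lee_fin.
  have := coord_le_edist x y i; have := Aa _ Ax; have := bB _ By.
  by rewrite distrC => *; have := ler_norm (tnth y i - tnth x i); lra.
have [->|] := eqVneq (hausdorff s (A `|` B)) +oo; first by rewrite leey.
rewrite -ltey => Hoo.
have fin (C : set (n.-tuple R)) : C `<=` A `|` B -> hausdorff s C \is a fin_num.
  move=> CAB; rewrite ge0_fin_numE ?outer_measure_ge0//.
  exact: le_lt_trans (le_outer_measure (@hausdorff R n s) _ _ CAB) Hoo.
rewrite -leeBrDr; last by apply: fin; exact: subsetUr.
apply: ge_ereal_sup => _ [e1 /= e10 <-].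
rewrite leeBrDr; last by apply: fin; exact: subsetUr.
rewrite addeC -leeBrDr; last first.
  rewrite ge0_fin_numE ?hausdorff_delta_ge0//.
  apply: le_lt_trans (hausdorff_delta_le _ _ e10) _.
  by rewrite -ge0_fin_numE ?outer_measure_ge0//; apply: fin; exact: subsetUl.
apply: ge_ereal_sup => _ [e2 /= e20 <-].
rewrite leeBrDr; last first.
  rewrite ge0_fin_numE ?hausdorff_delta_ge0//.
  apply: le_lt_trans (hausdorff_delta_le _ _ e10) _.
  by rewrite -ge0_fin_numE ?outer_measure_ge0//; apply: fin; exact: subsetUl.
(* One mesh finer than [e1] and [e2] and smaller than the gap; contents only grow when the mesh
   decreases. *)
pose e : R := Num.min (Num.min e1 e2) ((b - a) / 2)%R.
have e0 : (0 < e)%R by rewrite !lt_min e10 e20 /=; lra.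
have eba : (e < b - a)%R by rewrite gt_min; apply/orP; right; lra.
rewrite addeC; apply: le_trans (hausdorff_delta_le _ _ e0).
apply: le_trans (key _ e0 eba); apply: leeD; apply: hausdorff_delta_decr.
  by rewrite !ge_min lexx.
by rewrite !ge_min lexx orbT.
Qed.

(* Caratheodory's criterion: the slabs at distance between 1/(k+2) and 1/(k+1)
   from the half-space have summable measure, because each of them is at
   positive distance from the union of the earlier non-adjacent ones. *)
Lemma hausdorff_caratheodory_halfspace n s (i : 'I_n) (a : R) :
  (@hausdorff R n s).-caratheodory [set x | (tnth x i <= a)%R].
Proof.
set C := [set x | _]; apply: le_caratheodory_measurable => X.
change (hausdorff s (X `&` C) + hausdorff s (X `&` ~` C) <= hausdorff s X).
have [->|] := eqVneq (hausdorff s X) +oo; first by rewrite leey.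
rewrite -ltey => Xoo.
(* [Y k] is the part of [X] at distance at least 1/(k+1) beyond the half-space, and [S k] is the
   slab [Y k.+1] minus [Y k]. *)
pose Y k := X `&` [set x | a + k.+1%:R^-1 <= tnth x i]%R.
pose S k := X `&` [set x | a + k.+2%:R^-1 <= tnth x i < a + k.+1%:R^-1]%R.
have le_H (E F : set (n.-tuple R)) : E `<=` F -> hausdorff s E <= hausdorff s F.
  exact: le_outer_measure.
have H_ge0 (E : set (n.-tuple R)) : 0 <= hausdorff s E by exact: outer_measure_ge0.
(* The slab between 1/(k+3) and 1/(k+2) is separated from [Y k] by the slab [S k] lying between
   them. *)
have step k : hausdorff s (S k.+1) + hausdorff s (Y k) <= hausdorff s (Y k.+2).
  apply: (le_trans (@hausdorffU_separated _ _ _ _ i (a + k.+2%:R^-1)%R (a + k.+1%:R^-1)%R _ _ _)).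
  - by rewrite ltrD2l ltf_pV2 ?posrE// ltr_nat.
  - by move=> x [_ /andP[_ /ltW]].
  - by move=> x [].
  - apply: le_H => x [[Xx /andP[]]//|[Xx] /= xa]; split => //=.
    apply: le_trans xa; rewrite lerD2l lef_pV2 ?posrE// ler_nat.
    by rewrite !ltnS -addn2 leq_addr.
have CY k : hausdorff s (X `&` C) + hausdorff s (Y k) <= hausdorff s X.
  apply: (le_trans (@hausdorffU_separated _ _ _ _ i a (a + k.+1%:R^-1)%R _ _ _)).
  - by rewrite ltrDl invr_gt0.
  - by move=> x [].
  - by move=> x [].
  - by apply: le_H => x [[]|[]].
(* Adding the measure of [Y k.+1] to both sides of [step] makes it telescope over all slabs, even
   and odd ones together. *)
have sum_le k : \sum_(0 <= j < k) hausdorff s (S j.+1) +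
    (hausdorff s (Y 0%N) + hausdorff s (Y 1%N)) <=
    hausdorff s (Y k) + hausdorff s (Y k.+1).
  elim: k => [|k ih]; first by rewrite big_geq// add0e.
  rewrite big_nat_recr//= addeAC.
  apply: (le_trans (leeD2r _ ih)).
  by rewrite addeC addeA [leRHS]addeC leeD2r// step.
have Soo : \sum_(0 <= j <oo) hausdorff s (S j) < +oo.
  rewrite nneseries_recl// lte_add_pinfty//.
    by apply: le_lt_trans Xoo; apply: le_H => x [].
  rewrite -nneseries_addn//.
  apply: (@le_lt_trans _ _ (hausdorff s X + hausdorff s X)); last first.
    by rewrite lte_add_pinfty.
  apply: lime_le; first by apply: is_cvg_nneseries => k _ _.
  apply: nearW => k; rewrite (eq_bigr (fun j => hausdorff s (S j.+1))); last first.
    by move=> j _; rewrite addn1.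
  apply: le_trans (leeDl _ (adde_ge0 (H_ge0 (Y 0%N)) (H_ge0 (Y 1%N)))) _.
  by apply: le_trans (sum_le k) _; apply: leeD; apply: le_H => x [].
have XC k : hausdorff s (X `&` ~` C) <=
    hausdorff s (Y k) + \sum_(k <= j <oo) hausdorff s (S j).
  apply: le_trans (leeD2l _ (outer_measure_sigma_subadditive_tail
    (@hausdorff R n s) k S)).
  apply: le_trans (outer_measureU2 (@hausdorff R n s) _ _).
  apply: le_H => x [Xx] /= /negP; rewrite -ltNge => ax.
  have [kx|kx] := leP (a + k.+1%:R^-1)%R (tnth x i); first by left.
  right.
  (* The least such index exceeds [k], so it is a successor [l.+1], and by minimality the point lies
     in the slab [S l]. *)
  have exm : exists m, (a + m.+1%:R^-1 <= tnth x i)%R.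
    exists (Num.truncn (tnth x i - a)^-1).
    rewrite -lerBrDl -[leRHS]invrK lef_pV2 ?posrE ?invr_gt0 ?subr_gt0//.
    by rewrite ltW// truncnS_gt.
  have [l Pl ml] := ex_minnP exm.
  have lk : (k < l)%N.
    rewrite ltnNge; apply/negP => lk; move: kx; apply/negP; rewrite -leNgt.
    by apply: le_trans Pl; rewrite lerD2l lef_pV2 ?posrE// ler_nat.
  case: l lk Pl ml => // l kl Pl ml.
  exists l; first by move=> /=; apply/negP; rewrite -leqNgt.
  split => //=; rewrite Pl/= ltNge; apply/negP => /ml.
  by rewrite ltnn.
(* The tails of the convergent series tend to 0, so the bound given by [CY] and [XC] passes to the
   limit in [k]. *)
have tail0 := nneseries_tail_cvg Soo (fun k _ => H_ge0 (S k)).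
have fX : hausdorff s X \is a fin_num by rewrite ge0_fin_numE.
suff : hausdorff s (X `&` C) + hausdorff s (X `&` ~` C) <= hausdorff s X + 0.
  by rewrite adde0.
have : hausdorff s X + \sum_(k <= j <oo) hausdorff s (S j) @[k --> \oo]
    --> hausdorff s X + 0.
  by apply: cvgeD => //; [rewrite fin_num_adde_defr|exact: cvg_cst].
move=> cv; rewrite -(cvg_lim _ cv)//.
apply: lime_ge; first by apply/cvg_ex; eexists; exact: cv.
apply: nearW => k.
by apply: le_trans (leeD2l _ (XC k)) _; rewrite addeA leeD2r.
Qed.

(** The half-spaces generate the Borel sets: the identity from the Caratheodory sigma-algebra to the
    product one is measurable coordinate by coordinate. *)
Lemma measurable_hausdorff_caratheodory n s (A : set (n.-tuple R)) :
  measurable A -> (@hausdorff R n s).-caratheodory A.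
Proof.
move=> mA; pose T := caratheodory_type (@hausdorff R n s).
have mid : measurable_fun [set: T] (id : T -> n.-tuple R).
  apply/measurable_fun_tnthP => i /=.
  apply: (measurability _ (RGenOInfty.measurableE R)) => //=.
  move=> _ [_ [a ->] <-].
  rewrite setTI.
  rewrite (_ : _ @^-1` _ = ~` [set x : n.-tuple R | (tnth x i <= a)%R]).
    exact: caratheodory_measurable_setC (hausdorff_caratheodory_halfspace s i a).
  apply/seteqP; split => x /=; rewrite in_itv/= andbT.
    by move=> ax; apply/negP; rewrite -ltNge.
  by move=> /negP; rewrite -ltNge.
have := mid measurableT A mA.
by rewrite setTI.
Qed.

End hausdorff_theory.

Section hausdorff_measure.
Context {R : realType} (n s : nat).
Local Open Scope ereal_scope.

(** An outer measure is countably additive on its Caratheodory measurable sets, and these include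
    the Borel sets. *)
Let hausdorff_semi_sigma_additive :
  semi_sigma_additive (@hausdorff R n s : set (n.-tuple R) -> \bar R).
Proof.
move=> F mF tF mUF.
apply: (@caratheodory_measure_sigma_additive _ _ (@hausdorff R n s) F) => //.
- by move=> k; exact: measurable_hausdorff_caratheodory.
- exact: measurable_hausdorff_caratheodory.
Qed.

HB.instance Definition _ := isMeasure.Build _ (n.-tuple R) R (@hausdorff R n s)
  (outer_measure0 (@hausdorff R n s)) (outer_measure_ge0 (@hausdorff R n s))
  hausdorff_semi_sigma_additive.

End hausdorff_measure.

(** * Lebesgue measure on tuples *)

Section lebesgue_tuple_theory.
Context {R : realType}.
Local Open Scope ereal_scope.

Definition tadd n (v x : n.-tuple R) : n.-tuple R :=
  [tuple (tnth x i + tnth v i)%R | i < n].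

Lemma measurable_tadd2 n :
  measurable_fun setT (fun z : n.-tuple R * n.-tuple R => tadd z.1 z.2).
Proof.
apply/measurable_fun_tnthP => i.
rewrite (_ : _ \o _ = fun z : n.-tuple R * n.-tuple R =>
  (tnth z.2 i + tnth z.1 i)%R); last by apply/funext => z /=; rewrite tnth_mktuple.
apply: measurable_funD.
  exact: (measurableT_comp (@measurable_tnth _ _ n i) measurable_snd).
exact: (measurableT_comp (@measurable_tnth _ _ n i) measurable_fst).
Qed.

Lemma measurable_tadd n (v : n.-tuple R) : measurable_fun setT (tadd v).
Proof.
exact: (measurableT_comp (@measurable_tadd2 n) (measurable_pair1 v)).
Qed.

Definition box n (I : 'I_n -> set R) : set (n.-tuple R) :=
  [set x | forall i, I i (tnth x i)].

Lemma measurable_box n (I : 'I_n -> set R) :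
  (forall i, measurable (I i)) -> measurable (box I).
Proof.
move=> mI; rewrite (_ : box I = \bigcap_(i in [set: 'I_n]) ((@tnth n R)^~ i @^-1` I i)).
  apply: fin_bigcap_measurable => // i _.
  by rewrite -[X in measurable X]setTI; exact: measurable_tnth.
by apply/seteqP; split => x Ix i; [move=> _; exact: Ix|exact: (Ix i)].
Qed.

(** The push-forward by the translation gives half-open intervals their length, which characterizes
    Lebesgue measure. *)
Lemma lebesgue_measure_shift (a : R) (A : set (measurableTypeR R)) :
  measurable A ->
  lebesgue_measure ((fun x : R => x + a)%R @^-1` A) = lebesgue_measure A.
Proof.
move=> mA; have ms : measurable_fun [set: measurableTypeR R]
    ((fun x : R => x + a)%R : measurableTypeR R -> measurableTypeR R).
  by apply: measurable_funD.
apply/esym.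
apply: (@lebesgue_measure_unique R (pushforward lebesgue_measure
  ((fun x : R => x + a)%R : measurableTypeR R -> measurableTypeR R))) => //.
move=> _ [[u v] _ <-] /=; rewrite /pushforward.
rewrite (_ : _ @^-1` _ = `](u - a)%R, (v - a)%R]%classic); last first.
  by apply/seteqP; split => x /=; rewrite !in_itv/=; lra.
rewrite !lebesgue_measure_itv/= !lte_fin ltrD2r; case: ifPn => // _.
by rewrite -!EFinB; congr (_%:E); ring.
Qed.

Lemma lebesgue_tupleSE n (A : set (n.+1.-tuple R)) :
  lebesgue_tuple R n.+1 A =
  (@lebesgue_measure R \x lebesgue_tuple R n) (@tcons R n @^-1` A).
Proof. by []. Qed.

(** By induction on [n]: the translation acts on each factor of the product, and a product measure
    is determined by its values on rectangles. *)
Lemma lebesgue_tuple_shift n (v : n.-tuple R) A : measurable A ->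
  lebesgue_tuple R n (tadd v @^-1` A) = lebesgue_tuple R n A.
Proof.
elim: n v A => [|n ih] v A mA.
  by congr (lebesgue_tuple R 0 _); apply/seteqP; split => x /=;
    rewrite (tuple0 (tadd v x)) (tuple0 x).
rewrite !lebesgue_tupleSE.
pose v' : n.-tuple R := [tuple of behead v].
pose s (z : measurableTypeR R * n.-tuple R) : measurableTypeR R * n.-tuple R :=
  ((z.1 + thead v)%R, tadd v' z.2).
have ms : measurable_fun setT s.
  apply/measurable_fun_pair => /=; first exact: measurable_funD.
  exact: (measurableT_comp (@measurable_tadd n v')).
have vs z : tadd v (tcons z) = tcons (s z).
  apply: eq_from_tnth => i; rewrite tnth_mktuple.
  case: (unliftP ord0 i) => [j|] ->; last by rewrite !tnth0.
  rewrite !tnthS/= tnth_mktuple; congr (_ + _)%R.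
  by rewrite [in LHS](tuple_eta v) tnthS.
transitivity ((@lebesgue_measure R \x lebesgue_tuple R n) (s @^-1` (@tcons R n @^-1` A))).
  by congr (_ _); apply/seteqP; split => z /=; rewrite vs.
apply/esym.
apply: (@product_measure_unique _ _ _ _ _ _ _ (pushforward
  (@lebesgue_measure R \x lebesgue_tuple R n) s)); last first.
  by rewrite -[X in measurable X]setTI; exact: measurable_tcons.
move=> B C mB mC.
change ((@lebesgue_measure R \x lebesgue_tuple R n) (s @^-1` (B `*` C)) =
  lebesgue_measure B * lebesgue_tuple R n C).
rewrite (_ : s @^-1` _ = ((fun x : R => x + thead v)%R @^-1` B) `*` (tadd v' @^-1` C)).
  rewrite product_measure1E; first by congr (_ * _); [exact: lebesgue_measure_shift|exact: ih].
    rewrite -[X in measurable X]setTI.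
    by apply: (measurable_funD (@measurable_id _ _ _) (@measurable_cst _ _ _ _ _ _)).
  by rewrite -[X in measurable X]setTI; exact: measurable_tadd.
by apply/seteqP; split => z.
Qed.

Lemma lebesgue_tuple_box n (I : 'I_n -> set R) (r : R) :
  (forall i, measurable (I i)) ->
  (forall i, @lebesgue_measure R (I i) = r%:E) ->
  lebesgue_tuple R n (box I) = (r ^+ n)%:E.
Proof.
elim: n I => [|n ih] I mI Ir.
  by rewrite expr0 /= diracE mem_set//= => -[].
rewrite lebesgue_tupleSE.
rewrite (_ : _ @^-1` _ = I ord0 `*` box (I \o lift ord0)).
  rewrite product_measure1E//.
    transitivity (r%:E * (r ^+ n)%:E); last by rewrite -EFinM -exprS.
    by congr (_ * _); [exact: Ir|apply: ih => i; [exact: mI|exact: Ir]].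
    exact: (mI ord0).
  exact: (measurable_box (fun i => mI (lift ord0 i))).
apply/seteqP; split => -[z t] /=.
  by move=> Izt; split => [|i] /=; [exact: (Izt ord0)|have := Izt (lift ord0 i); rewrite tnthS].
by move=> [Iz It] i; case: (unliftP ord0 i) => [j|] ->; rewrite ?tnthS//; exact: It.
Qed.

End lebesgue_tuple_theory.

(** * Translation-invariant measures *)

Section invariant_measures.
Context {R : realType} {n : nat}.
Local Open Scope ereal_scope.

Definition topp (x : n.-tuple R) : n.-tuple R := [tuple (- tnth x i)%R | i < n].

Lemma measurable_topp : measurable_fun setT topp.
Proof.
apply/measurable_fun_tnthP => i.
rewrite (_ : _ \o _ = fun z : n.-tuple R => (- tnth z i)%R); last first.
  by apply/funext => z /=; rewrite tnth_mktuple.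
exact: (measurableT_comp (@oppr_measurable R setT) (@measurable_tnth _ _ n i)).
Qed.

Lemma product_measureT_swap (mu nu : {sigma_finite_measure set (n.-tuple R) -> \bar R})
    (E : set (n.-tuple R * n.-tuple R)) : measurable E ->
  \int[mu]_x nu (xsection E x) = \int[nu]_y mu (ysection E y).
Proof.
move=> mE; have := @indic_fubini_tonelli _ _ _ _ _ mu nu _ mE.
by rewrite indic_fubini_tonelli_FE// indic_fubini_tonelli_GE.
Qed.

Lemma integral_indicZr (mu : {measure set (n.-tuple R) -> \bar R}) A (c : \bar R) :
  measurable A -> 0 <= c -> \int[mu]_x ((\1_A x)%:E * c) = mu A * c.
Proof.
move=> mA c0; rewrite ge0_integralZr//; first by rewrite integral_indic// setIT.
by apply/measurable_EFinP; exact: measurable_indic.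
Qed.

(* Evaluate in two ways the integral of 1_A(x) 1_B(y - x) with respect to
   mu(dx) nu(dy), substituting x + y for x. *)
Lemma shift_invariant_measures_proportional
    (mu nu : {sigma_finite_measure set (n.-tuple R) -> \bar R}) :
  (forall v A, measurable A -> mu (tadd v @^-1` A) = mu A) ->
  (forall v A, measurable A -> nu (tadd v @^-1` A) = nu A) ->
  forall A B, measurable A -> measurable B ->
  mu A * nu B = nu A * mu (topp @^-1` B).
Proof.
move=> mui nui A B mA mB.
(* [E1] carries the integrand 1_A(x) 1_B(y - x), and [E2] the integrand 1_A(x + y) 1_B(-x) obtained
   by the substitution. *)
pose E1 := [set z : n.-tuple R * n.-tuple R | A z.1 /\ B (tadd (topp z.1) z.2)].
pose E2 := [set z : n.-tuple R * n.-tuple R | A (tadd z.1 z.2) /\ B (topp z.1)].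
have pre (f : n.-tuple R * n.-tuple R -> n.-tuple R) C :
    measurable_fun setT f -> measurable C -> measurable (f @^-1` C).
  by move=> mf mC; rewrite -[X in measurable X]setTI; exact: mf.
have mE1 : measurable E1.
  apply: measurableI; first exact: (pre fst).
  apply: (pre (fun z => tadd (topp z.1) z.2)) => //.
  have mp : measurable_fun setT
      (fun z : n.-tuple R * n.-tuple R => (topp z.1, z.2)).
    apply/measurable_fun_pair => /=; last exact: measurable_snd.
    exact: (measurableT_comp measurable_topp measurable_fst).
  exact: (measurableT_comp (@measurable_tadd2 R n) mp).
have mE2 : measurable E2.
  apply: measurableI; first exact: (pre (fun z => tadd z.1 z.2) _ (@measurable_tadd2 R n)).
  exact: (pre (topp \o fst) _ (measurableT_comp measurable_topp measurable_fst)).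
have mTB : measurable (topp @^-1` B).
  by rewrite -[X in measurable X]setTI; exact: measurable_topp.
(* For x in [A] the section of [E1] is a translate of [B], of measure [nu B]; for other x it is
   empty. *)
transitivity (\int[mu]_x nu (xsection E1 x)).
  rewrite -integral_indicZr//; apply: eq_integral => x _.
  rewrite indicE; have [xA|xA] := boolP (x \in A).
    rewrite mul1e -(nui (topp x))//; congr (nu _).
    apply/seteqP; split => y; first by move=> By; apply/xsectionP; split => //; exact: set_mem.
    by move=> /xsectionP[].
  rewrite mul0e (_ : xsection _ _ = set0) ?measure0//.
  apply/seteqP; split => y // /xsectionP[Ax _].
  by move: xA; rewrite mem_set.
rewrite product_measureT_swap//.
transitivity (\int[nu]_y mu (ysection E2 y)).
  (* For fixed y the two sections are translates of each other by y, so [mu] does not distinguish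
     them. *)
  apply: eq_integral => y _; rewrite -[RHS](mui (topp y)); last exact: measurable_ysection.
  congr (mu _); apply/seteqP.
  have e1 x : tadd (tadd (topp y) x) y = x.
    by apply: eq_from_tnth => i; rewrite !tnth_mktuple; ring.
  have e2 x : topp (tadd (topp y) x) = tadd (topp x) y.
    by apply: eq_from_tnth => i; rewrite !tnth_mktuple; ring.
  split=> x.
    by move=> /ysectionP[/= Ax Bx]; apply/ysectionP; rewrite /E2/= e1 e2.
  by move=> /ysectionP; rewrite /E2/= e1 e2 => -[Ax Bx]; apply/ysectionP.
(* After exchanging the integrals back, the section of [E2] at x is a translate of [A] when -x lies
   in [B], and empty otherwise. *)
rewrite -product_measureT_swap// [RHS]muleC -integral_indicZr//.
apply: eq_integral => x _; rewrite indicE; have [xB|xB] := boolP (x \in _).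
  rewrite mul1e -[RHS](nui x)//; congr (nu _).
  apply/seteqP; split => y; first by move=> /xsectionP[].
  by move=> Ay; apply/xsectionP; split => //; exact: set_mem xB.
rewrite mul0e (_ : xsection _ _ = set0) ?measure0//.
apply/seteqP; split => y // /xsectionP[_ Bx].
by move: xB; rewrite mem_set.
Qed.

End invariant_measures.

(** * Hausdorff measure on the hyperplane of the simplex *)

Section simplex_chart_theory.
Context {R : realType} {d : nat}.
Local Notation chart := (@simplex_chart R d).

Definition hyper : set (d.+1.-tuple R) := [set p | \sum_k tnth p k = 1].

Definition proj (p : d.+1.-tuple R) : d.-tuple R :=
  [tuple tnth p (widen_ord (leqnSn d) i) | i < d].

Lemma tnth_chart x i : tnth (chart x) (widen_ord (leqnSn d) i) = tnth x i.
Proof.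
by rewrite !(tnth_nth 0) /= nth_rcons size_tuple ltn_ord.
Qed.

Lemma tnth_chart_max x : tnth (chart x) ord_max = 1 - \sum_k tnth x k.
Proof. by rewrite (tnth_nth 0) /= nth_rcons size_tuple ltnn eqxx. Qed.

Lemma projK x : proj (chart x) = x.
Proof. by apply: eq_from_tnth => i; rewrite tnth_mktuple tnth_chart. Qed.

Lemma hyper_chart x : hyper (chart x).
Proof.
rewrite /hyper/= big_ord_recr/= tnth_chart_max.
by under eq_bigr do rewrite tnth_chart; rewrite addrC subrK.
Qed.

Lemma eq_from_tnth_max (p q : d.+1.-tuple R) :
  (forall i, tnth p (widen_ord (leqnSn d) i) = tnth q (widen_ord (leqnSn d) i)) ->
  tnth p ord_max = tnth q ord_max -> p = q.
Proof.
move=> pq pqm; apply: eq_from_tnth => k.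
have [->//|kd] := eqVneq k ord_max.
have kd' : (k < d)%N by rewrite ltn_neqAle -ltnS ltn_ord andbT.
by rewrite (_ : k = widen_ord (leqnSn d) (Ordinal kd')) //; exact: val_inj.
Qed.

Lemma chartK p : hyper p -> chart (proj p) = p.
Proof.
rewrite /hyper/= => p1; apply: eq_from_tnth_max => [i|].
  by rewrite tnth_chart tnth_mktuple.
rewrite tnth_chart_max; under eq_bigr do rewrite tnth_mktuple.
by rewrite -p1 big_ord_recr/= addrAC subrr add0r.
Qed.

Lemma measurable_chart : measurable_fun setT chart.
Proof.
apply/measurable_fun_tnthP => k.
have [->|kd] := eqVneq k ord_max.
  rewrite (_ : _ \o _ = (fun x => 1 - \sum_k tnth x k)); last first.
    by apply/funext => x /=; rewrite tnth_chart_max.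
  apply: measurable_funB => //; apply: measurable_sum => i.
  exact: measurable_tnth.
have kd' : (k < d)%N by rewrite ltn_neqAle -ltnS ltn_ord andbT.
rewrite (_ : _ \o _ = (fun x => tnth x (Ordinal kd'))); first exact: measurable_tnth.
apply/funext => x /=; rewrite -tnth_chart; congr (tnth _ _); exact: val_inj.
Qed.

Lemma measurable_proj : measurable_fun setT proj.
Proof.
apply/measurable_fun_tnthP => i.
rewrite (_ : _ \o _ = (fun p => tnth p (widen_ord (leqnSn d) i))).
  exact: measurable_tnth.
by apply/funext => p /=; rewrite tnth_mktuple.
Qed.

Lemma measurable_hyper : measurable hyper.
Proof.
rewrite (_ : hyper = (fun p => \sum_k tnth p k) @^-1` [set 1]); last first.
  by apply/seteqP; split.
rewrite -[X in measurable X]setTI; have : measurable_fun setT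
    (fun p : d.+1.-tuple R => \sum_k tnth p k).
  by apply: measurable_sum => k; exact: measurable_tnth.
by apply => //; exact: measurable_set1.
Qed.

Lemma image_chartE B : chart @` B = hyper `&` proj @^-1` B.
Proof.
apply/seteqP; split => [_ [x Bx <-]|p [hp Bp]].
  by split; [exact: hyper_chart|rewrite /= projK].
by exists (proj p) => //; exact: chartK.
Qed.

Lemma measurable_image_chart B : measurable B -> measurable (chart @` B).
Proof.
move=> mB; rewrite image_chartE; apply: measurableI; first exact: measurable_hyper.
by rewrite -[X in measurable X]setTI; exact: measurable_proj.
Qed.

(** The chart is affine with linear part v |-> (v, - sum v), so translations of R^d become
    translations along the hyperplane. *)
Lemma chart_tadd v x : chart (tadd v x) =
  tadd [tuple of rcons v (- \sum_k tnth v k)] (chart x).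
Proof.
apply: eq_from_tnth_max => [i|].
  rewrite tnth_chart !tnth_mktuple tnth_chart; congr (_ + _).
  by rewrite [RHS](tnth_nth 0)/= nth_rcons size_tuple ltn_ord (tnth_nth 0).
rewrite tnth_mktuple !tnth_chart_max.
rewrite [X in _ = _ + X](tnth_nth 0)/= nth_rcons size_tuple ltnn eqxx.
under eq_bigr do rewrite tnth_mktuple.
by rewrite big_split/=; ring.
Qed.

End simplex_chart_theory.

(** * The pull-back of the Hausdorff measure by the chart *)

Section chart_measure.
Context {R : realType} (d : nat).
Local Open Scope ereal_scope.
Local Notation chart := (@simplex_chart R d).

Lemma edist_tadd n (v x y : n.-tuple R) : edist (tadd v x) (tadd v y) = edist x y.
Proof.
rewrite /edist; congr Num.sqrt; apply: eq_bigr => i _.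
by rewrite !tnth_mktuple; congr (_ ^+ 2)%R; ring.
Qed.

Lemma hausdorff_tadd n s (v : n.-tuple R) A :
  hausdorff s (tadd v @` A) = hausdorff s A.
Proof.
apply: (@hausdorff_bij _ _ _ _ (tadd (topp v))); last 2 first.
- by move=> x y; exact: edist_tadd.
- by move=> x y; exact: edist_tadd.
by move=> x; apply: eq_from_tnth => i; rewrite !tnth_mktuple; ring.
Qed.

Definition chart_measure (B : set (d.-tuple R)) : \bar R :=
  hausdorff d (chart @` B).

Let chart_measure0 : chart_measure set0 = 0.
Proof. by rewrite /chart_measure image_set0 measure0. Qed.

Let chart_measure_ge0 B : 0 <= chart_measure B.
Proof. exact: measure_ge0. Qed.

Let chart_measure_sigma_additive : semi_sigma_additive chart_measure.
Proof.
move=> F mF tF mUF; rewrite /chart_measure image_bigcup.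
apply: measure_semi_sigma_additive.
- by move=> k; exact: measurable_image_chart.
- apply/trivIsetP => i j _ _ ij; rewrite -subset0 => _ [[x Fx <-] [y Fy]].
  move=> /(congr1 proj); rewrite !projK => yx.
  move/trivIsetP : tF => /(_ i j Logic.I Logic.I ij); rewrite -subset0; apply.
  by split; [exact: Fx|rewrite -yx].
- by rewrite -image_bigcup; exact: measurable_image_chart.
Qed.

HB.instance Definition _ := isMeasure.Build _ _ _ chart_measure
  chart_measure0 chart_measure_ge0 chart_measure_sigma_additive.

Lemma chart_measure_shift v A : chart_measure (tadd v @^-1` A) = chart_measure A.
Proof.
rewrite /chart_measure -(hausdorff_tadd _ [tuple of rcons v (- \sum_k tnth v k)%R]).
congr (hausdorff d _); rewrite image_comp; apply/seteqP; split.
  by move=> _ [x Ax <-]; exists (tadd v x) => //; rewrite chart_tadd.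
move=> _ [x Ax <-]; exists (tadd (topp v) x) => /=.
  rewrite (_ : tadd _ _ = x)//.
  by apply: eq_from_tnth => i; rewrite !tnth_mktuple; ring.
rewrite -chart_tadd; congr (chart _).
by apply: eq_from_tnth => i; rewrite !tnth_mktuple; ring.
Qed.

Lemma edist_le_sum n (x y : n.-tuple R) :
  (edist x y <= \sum_i `|tnth x i - tnth y i|)%R.
Proof.
rewrite /edist -[leRHS]ger0_norm ?sumr_ge0// -sqrtr_sqr ler_wsqrtr//.
(* The relation a <= b^2 with b >= 0 is stable under adding pairs, which allows an induction on both
   sums at once. *)
pose K (a b : R) := (0 <= b /\ a <= b ^+ 2)%R.
suff : K (\sum_i (tnth x i - tnth y i) ^+ 2)%R (\sum_i `|tnth x i - tnth y i|)%R by case.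
apply: (big_ind2 K); rewrite /K.
- by rewrite expr0n.
- move=> a b a' b' [b0 ab] [b'0 ab']; split; first exact: addr_ge0.
  by rewrite sqrrD; have := mulr_ge0 b0 b'0; lra.
- by move=> i _; split => //; rewrite real_normK// num_real.
Qed.

(** The first [d] coordinates contribute at most [h] each, and the last one, a sum of [d] such
    differences, at most [d * h]. *)
Lemma edist_chart_le (x y : d.-tuple R) (h : R) :
  (forall i, `|tnth x i - tnth y i| <= h)%R ->
  (edist (chart x) (chart y) <= (2 * d)%:R * h)%R.
Proof.
move=> xyh; apply: le_trans (edist_le_sum _ _) _.
rewrite big_ord_recr/= !tnth_chart_max.
under eq_bigr do rewrite !tnth_chart.
have S : (\sum_(i < d) `|tnth x i - tnth y i| <= d%:R * h)%R.
  apply: (@le_trans _ _ (\sum_(i < d) h)%R); first by apply: ler_sum => i _.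
  by rewrite sumr_const card_ord mulr_natl.
rewrite (_ : (1 - _ - _ = \sum_(i < d) (tnth y i - tnth x i))%R); last first.
  by rewrite sumrB; ring.
have := ler_norm_sum (index_enum 'I_d) (fun i => tnth y i - tnth x i)%R xpredT.
under [X in (_ <= X)%R]eq_bigr do rewrite distrC.
by rewrite natrM => T; lra.
Qed.

(** Cut the cube into m^d cells of side r/m. Their images have diameter at most 2dr/m, so the total
    weight is at most m^d (2dr/m)^d = (2dr)^d for every m. *)
Lemma chart_measure_cube (a r : R) : (0 < r)%R ->
  chart_measure (box (fun=> `[a, (a + r)%R[%classic)) <= ((2 * d)%:R * r)%:E ^+ d.
Proof.
move=> r0; apply: ge_ereal_sup => _ [e /= e0 <-].
pose C := ((2 * d)%:R * r)%R; pose m := (Num.truncn (C / e)).+1.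
have C0 : (0 <= C)%R by rewrite mulr_ge0// ltW.
have Cme : (C / m%:R <= e)%R.
  by rewrite ler_pdivrMr// mulrC -ler_pdivrMr// ltW// truncnS_gt.
pose I (j : nat) := `[(a + r / m%:R * j%:R)%R, (a + r / m%:R * j.+1%:R)%R[%classic.
pose Q (f : {ffun 'I_d -> 'I_m}) := chart @` (box (fun i => I (f i))).
have Qdiam f : diam (Q f) <= (C / m%:R)%:E.
  apply: diam_le => [|_ _ [x Qx <-] [y Qy <-]]; first by rewrite lee_fin divr_ge0.
  rewrite lee_fin /C -mulrA; apply: edist_chart_le => i.
  have := Qx i; have := Qy i; rewrite /I/= !in_itv/= -natr1 mulrDr mulr1 addrA.
  by rewrite ler_norml => *; lra.
(* The finitely many cells are listed by rank, and the sequence is completed with empty sets. *)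
pose U k := if insub k is Some i then Q (enum_val (i : 'I_#|{: {ffun 'I_d -> 'I_m}}|))
            else set0.
apply: (@le_trans _ _ (\sum_(k <oo) hweight d (U k))).
  apply: ereal_inf_lbound; exists U => //; split.
    move=> _ [x xa <-].
    have m0 : (0 < m%:R :> R)%R by [].
    (* The cell containing [x] has in direction [i] the index floor((x_i - a) m / r). *)
    have lt_m i : (Num.truncn ((tnth x i - a) / r * m%:R) < m)%N.
      have := xa i; rewrite /= in_itv/= => /andP[ax xr].
      have q0 : (0 <= (tnth x i - a) / r)%R by apply: divr_ge0; [rewrite subr_ge0|exact: ltW].
      rewrite truncn_lt_nat; last by rewrite mulr_ge0// ler0n.
      by rewrite -[X in (_ < X)%R]mul1r ltr_pM2r// ltr_pdivrMr// mul1r; lra.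
    pose f : {ffun 'I_d -> 'I_m} := [ffun i => Ordinal (lt_m i)].
    exists (val (enum_rank f)) => //.
    rewrite /U valK enum_rankK; exists x => //= i.
    have := xa i; rewrite /I /= !in_itv/= ffunE/= => /andP[ax xr].
    have q0 : (0 <= (tnth x i - a) / r * m%:R)%R.
      by rewrite mulr_ge0//; apply: divr_ge0; [rewrite subr_ge0|exact: ltW].
    have /andP[q1 q2] := truncn_itv q0.
    have rm0 : (0 < r / m%:R)%R by rewrite divr_gt0.
    have qE : (tnth x i - a = r / m%:R * ((tnth x i - a) / r * m%:R))%R.
      by field; rewrite gt_eqF// pnatr_eq0.
    rewrite -lerBrDl -ltrBlDl; set t := Num.truncn _ in q1 q2 *.
    rewrite qE ler_pM2l// ltr_pM2l//.
    by rewrite q1 q2.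
  move=> k; rewrite /U; case: insubP => [i _ _|_]; last by rewrite diam0 lee_fin ltW.
  by apply: le_trans (Qdiam _) _; rewrite lee_fin.
pose N := #|{: {ffun 'I_d -> 'I_m}}|.
rewrite (nneseries_split _ N)//; last by move=> k _; exact: hweight_ge0.
rewrite [X in _ + X]eseries0 ?adde0; last first.
  by move=> k Nk _; rewrite /U insubF ?hweight_set0// ltnNge Nk.
apply: (@le_trans _ _ (\sum_(0 <= k < N) (C / m%:R)%:E ^+ d)).
  apply: lee_sum => k _.
  have : hweight d (U k) <= diam (U k) ^+ d.
    rewrite /hweight; case: ifPn => _; last exact: lexx.
    by apply: expe_ge0; exact: diam_ge0.
  move=> /le_trans; apply.
  have : diam (U k) <= (C / m%:R)%:E.
    by rewrite /U; case: insubP => [i _ _|_]; rewrite ?Qdiam// diam0 lee_fin divr_ge0.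
  by apply: lee_expe2r; exact: diam_ge0.
rewrite -!EFin_expe sumEFin lee_fin sumr_const_nat subn0 /N card_ffun !card_ord.
rewrite -[X in (X <= _)%R]mulr_natr natrX -exprMn divfK//.
by rewrite pnatr_eq0.
Qed.

Let chart_measure_sigma_finite : sigma_finite setT chart_measure.
Proof.
exists (fun k => box (fun=> `[(- k.+1%:R)%R, (- k.+1%:R + 2 * k.+1%:R)%R[%classic)).
  apply/esym; rewrite -subTset => x _.
  have [k xk] : exists k, forall i, (`|tnth x i| < k.+1%:R)%R.
    exists (Num.truncn (\sum_i `|tnth x i|)%R) => i.
    apply: le_lt_trans (truncnS_gt _).
    by rewrite (bigD1 i)//= lerDl sumr_ge0.
  exists k => // i /=; rewrite in_itv/=; have := xk i; rewrite ltr_norml.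
  by move=> /andP[]; lra.
move=> k; split; first by apply: measurable_box => i; exact: measurable_itv.
apply: le_lt_trans (chart_measure_cube _ _) _; first by rewrite mulr_gt0.
by rewrite -EFin_expe ltey.
Qed.

HB.instance Definition _ := Measure_isSigmaFinite.Build _ _ _ chart_measure
  chart_measure_sigma_finite.

(** A set of diameter r lies in a cube of side 2r centred at one of its points, of Lebesgue measure
    2^n r^n; sum this over a cover. *)
Lemma lebesgue_tuple_le_hausdorff n (B : set (n.-tuple R)) : measurable B ->
  lebesgue_tuple R n B <= (2 ^+ n)%:E * hausdorff n B.
Proof.
move=> mB; rewrite muleC -lee_pdivrMr//.
(* Covers of mesh 1 are enough; the mesh only serves to make all diameters finite. *)
apply: le_trans (hausdorff_delta_le _ _ (@ltr01 R)).
apply: le_ereal_inf_tmp => _ [U [BU dU] <-].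
rewrite lee_pdivrMr// muleC -nneseriesZl//; last by move=> k _; exact: hweight_ge0.
have dUf k : diam (U k) \is a fin_num.
  rewrite ge0_fin_numE ?diam_ge0//; apply: le_lt_trans (dU k) _.
  by rewrite ltey.
pose r k := fine (diam (U k)).
have r0 k : (0 <= r k)%R by rewrite fine_ge0// diam_ge0.
pose V k : set (n.-tuple R) := if pselect (U k !=set0) is left U0
  then box (fun i => `[(tnth (projT1 (cid U0)) i - r k)%R,
                       (tnth (projT1 (cid U0)) i + r k)%R]%classic)
  else set0.
have mV k : measurable (V k).
  rewrite /V; case: pselect => // U0.
  by apply: measurable_box => i; exact: measurable_itv.
have UV k : U k `<=` V k.
  move=> x Ux; rewrite /V; case: pselect => [U0|]; last by case; exists x.
  move=> i /=; rewrite in_itv/=; case: cid => y Uy /=.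
  have := edist_le_diam Ux Uy; rewrite -(fineK (dUf k)) lee_fin -/(r k).
  have := coord_le_edist x y i; rewrite ler_norml.
  by move=> /andP[]; lra.
apply: (@le_trans _ _ (\sum_(k <oo) lebesgue_tuple R n (V k))).
  apply: measure_sigma_subadditive => // x /BU [k _ Ux]; exists k => //.
  exact: UV.
apply: lee_nneseries => k _ //.
rewrite /V; case: pselect => U0; last by rewrite measure0 mule_ge0 ?hweight_ge0// lee_fin exprn_ge0.
rewrite (@lebesgue_tuple_box _ _ _ (2 * r k)%R).
- rewrite /hweight ifF; last by apply/eqP => U1; case: U0 => x; rewrite U1.
  by rewrite -(fineK (dUf k)) -EFin_expe -EFinM lee_fin exprMn.
- by move=> i; exact: measurable_itv.
move=> i; rewrite lebesgue_measure_itv/= lte_fin.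
case: ifPn => [_|]; first by rewrite -EFinB; congr (_%:E); ring.
by rewrite -leNgt => ?; congr (_%:E); have := r0 k; lra.
Qed.

Lemma hausdorff_hyper : exists2 K : R, (0 < K)%R & forall A, measurable A ->
  hausdorff d (A `&` hyper) = K%:E * lebesgue_tuple R d (chart @^-1` A).
Proof.
pose B : set (d.-tuple R) := box (fun=> `[0%R, (0 + 1)%R[%classic).
have mB : measurable B by apply: measurable_box => i; exact: measurable_itv.
have fB : chart_measure B \is a fin_num.
  rewrite ge0_fin_numE ?chart_measure_ge0//.
  by apply: le_lt_trans (chart_measure_cube _ _) _ => //; rewrite -EFin_expe ltey.
have LB : lebesgue_tuple R d (topp @^-1` B) = 1.
  rewrite (_ : _ @^-1` _ = box (fun=> `](-1)%R, 0%R]%classic)).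
    rewrite (@lebesgue_tuple_box _ _ _ 1) ?expr1n//.
    move=> i; rewrite lebesgue_measure_itv/= lte_fin ltrN10.
    by rewrite -EFinB; congr (_%:E); ring.
  by apply/seteqP; split => x xB i; have := xB i; rewrite /= !in_itv/= tnth_mktuple; lra.
have LB1 : lebesgue_tuple R d B = 1.
  rewrite (@lebesgue_tuple_box _ _ _ 1) ?expr1n//.
  by move=> i; rewrite lebesgue_measure_itv/= lte_fin add0r ltr01 sube0.
(* [K] is the measure of the image of the unit cube, because the reflected cube has Lebesgue measure
   1. *)
exists (fine (chart_measure B)).
  rewrite fine_gt0// -ge0_fin_numE ?chart_measure_ge0// fB andbT.
  rewrite lt_neqAle chart_measure_ge0 andbT eq_sym; apply/eqP => B0.
  (* If [K] were 0, then so would be the Hausdorff measure of [B], as [proj] is a contraction from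
     the image back onto [B]; this contradicts the lower bound by Lebesgue measure. *)
  have := lebesgue_tuple_le_hausdorff mB; rewrite LB1.
  rewrite (_ : hausdorff d B = 0) ?mule0 ?lee_fin ?ler10//.
  apply/eqP; rewrite eq_le measure_ge0 andbT -B0 /chart_measure.
  rewrite -[X in hausdorff d X <= _](_ : proj @` (chart @` B) = B).
    apply: hausdorff_image_le => x y; rewrite /edist ler_wsqrtr//.
    rewrite [leRHS]big_ord_recr/=.
    under eq_bigr do rewrite !tnth_mktuple.
    by rewrite lerDl sqr_ge0.
  by rewrite image_comp (_ : _ \o _ = id) ?image_id//; apply/funext => x /=; exact: projK.
move=> A mA; rewrite fineK//.
have mcA : measurable (chart @^-1` A).
  by rewrite -[X in measurable X]setTI; exact: measurable_chart.
have := @shift_invariant_measures_proportional _ _ (lebesgue_tuple R d)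
  chart_measure (@lebesgue_tuple_shift R d) (fun v A _ => chart_measure_shift v A) _ _ mcA mB.
rewrite LB mule1 muleC => ->; rewrite /= /chart_measure; congr (hausdorff d _).
apply/seteqP; split.
  by move=> p [Ap hp]; exists (proj p); rewrite /= ?chartK.
by move=> _ [x Ax <-]; split => //; exact: hyper_chart.
Qed.

End chart_measure.

(** * Gamma and Beta integrals at integers *)

Section primitives.
Context {R : realType}.

Lemma is_derive_continuous (F : R -> R) (x f : R) :
  is_derive x 1 F f -> {for x, continuous F}.
Proof. by move=> [dF _]; apply/differentiable_continuous/derivable1_diffP. Qed.

Lemma integral_itv_primitive (f F : R -> R) (a b : R) : a <= b ->
  continuous f -> (forall x : R, is_derive x 1 F (f x)) ->
  (\int[lebesgue_measure]_(x in `[a, b]) (f x)%:E = (F b - F a)%:E)%E.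
Proof.
rewrite le_eqVlt => /predU1P[<-|ab] cf dF.
  by rewrite set_itv1 integral_set1 subrr.
have cF x : {for x, continuous F} by apply: is_derive_continuous (dF x).
rewrite (@continuous_FTC2 _ _ F)//.
- exact: continuous_subspaceT.
- split; first by move=> x _; exact: ex_derive.
    exact/cvg_at_right_filter/cF.
  exact/cvg_at_left_filter/cF.
- by move=> x _; rewrite derive1E; apply: derive_val.
Qed.

(** The antiderivative of x^m (t - x)^n produced by repeated integration by parts, each step
    lowering [m] and raising [n]. *)
Fixpoint beta_primitive (t : R) (m n : nat) : R -> R :=
  if m is m'.+1 then
    - n.+1%:R^-1 *: (id ^+ m'.+1 * (cst t - id) ^+ n.+1)
    + (m'.+1%:R / n.+1%:R) *: beta_primitive t m' n.+1
  else - n.+1%:R^-1 *: (cst t - id) ^+ n.+1.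

Lemma is_derive_beta_primitive (t : R) m n (x : R) :
  is_derive x 1 (beta_primitive t m n) (x ^+ m * (t - x) ^+ n).
Proof.
elim: m n => [|m ih] n /=.
  apply: is_derive_eq; rewrite !fctE /GRing.scale/=.
  have n0 : n.+1%:R != 0 :> R by rewrite pnatr_eq0.
  by move: n.+1%:R n0 => u u0; field; exact: u0.
have := ih n.+1; move: (beta_primitive t m n.+1) => G dG.
have d1 : is_derive x 1 (id ^+ m.+1 * (cst t - id) ^+ n.+1 : R -> R)
    (m.+1%:R * x ^+ m * (t - x) ^+ n.+1 - n.+1%:R * x ^+ m.+1 * (t - x) ^+ n).
  by apply: is_derive_eq; rewrite !fctE /GRing.scale/=; ring.
apply: (is_derive_eq (is_deriveD (is_deriveZ _ d1) (is_deriveZ _ dG))).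
rewrite /GRing.scale/= !exprS.
have n0 : n.+1%:R != 0 :> R by rewrite pnatr_eq0.
by move: n.+1%:R m.+1%:R n0 => u v u0; field; exact: u0.
Qed.

Lemma beta_primitive_right t m n : beta_primitive t m n t = 0.
Proof.
elim: m n => [|m ih] n /=; rewrite !fctE /GRing.scale/= subrr expr0n/= ?mulr0//.
by rewrite ih !mulr0 addr0.
Qed.

(** For positive [m] the boundary term vanishes at 0, so only the recursive term contributes and the
    factors m/(n+1) accumulate into factorials. *)
Lemma beta_primitive_left t m n : beta_primitive t m n 0 =
  - ((m`! * n`!)%:R / (m + n).+1`!%:R * t ^+ (m + n).+1).
Proof.
elim: m n => [|m ih] n.
  rewrite (_ : beta_primitive _ _ _ _ = - n.+1%:R^-1 * (t - 0) ^+ n.+1).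
    rewrite subr0.
    rewrite mulNr fact0 mul1n add0n factS natrM; congr (- (_ * _)).
    have n0 : n.+1%:R != 0 :> R by rewrite pnatr_eq0.
    have f0 : n`!%:R != 0 :> R by rewrite pnatr_eq0 -lt0n fact_gt0.
    by move: n.+1%:R n`!%:R n0 f0 => u v u0 v0; field; rewrite ?u0 ?v0.
  by rewrite /= !fctE.
rewrite (_ : beta_primitive _ _ _ _ = - n.+1%:R^-1 * (0 ^+ m.+1 * (t - 0) ^+ n.+1)
    + m.+1%:R / n.+1%:R * beta_primitive t m n.+1 0); last by rewrite /= !fctE.
rewrite ih expr0n mul0r mulr0 add0r mulrN addnS addSn; congr (- _).
rewrite mulrA; congr (_ * _).
have n0 : n.+1%:R != 0 :> R by rewrite pnatr_eq0.
have : (m + n).+2`!%:R != 0 :> R by rewrite pnatr_eq0 -lt0n fact_gt0.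
move: ((m + n).+2`!%:R : R) => v v0; rewrite (factS m) (factS n) !natrM.
move: n.+1%:R n0 m.+1%:R m`!%:R n`!%:R => u u0 a b c.
by field; rewrite u0 v0.
Qed.

Lemma continuous_beta_kernel t m n :
  continuous (fun x : R => x ^+ m * (t - x) ^+ n).
Proof.
move=> x; apply: cvgM; first exact: exprn_continuous.
apply: (@continuous_comp _ _ _ (fun x : R => t - x) (fun x => x ^+ n)).
  by apply: cvgB; [exact: cvg_cst|exact: cvg_id].
exact: exprn_continuous.
Qed.

(** This is the Beta integral with parameters m+1 and n+1, rescaled from [0, 1] to [0, t]. *)
Lemma integral_beta_kernel (t : R) m n : 0 <= t ->
  (\int[lebesgue_measure]_(x in `[0%R, t]) (x ^+ m * (t - x) ^+ n)%:E =
   ((m`! * n`!)%:R / (m + n).+1`!%:R * t ^+ (m + n).+1)%:E)%E.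
Proof.
move=> t0; rewrite (integral_itv_primitive t0 (@continuous_beta_kernel t m n)
  (is_derive_beta_primitive t m n)).
by rewrite beta_primitive_right beta_primitive_left sub0r opprK.
Qed.

(** The antiderivative of x^n exp(-x) that vanishes at infinity, again by repeated integration by
    parts. *)
Fixpoint Gamma_primitive (n : nat) : R -> R :=
  if n is m.+1 then
    - (id ^+ m.+1 * (expR \o -%R)) + m.+1%:R *: Gamma_primitive m
  else - (expR \o -%R).

Lemma is_derive_Gamma_primitive n (x : R) :
  is_derive x 1 (Gamma_primitive n) (x ^+ n * expR (- x)).
Proof.
elim: n => [|n] /=.
  by apply: is_derive_eq; rewrite mulrN1 opprK expr0 mul1r.
move: (Gamma_primitive n) => G dG.
apply: is_derive_eq; rewrite !fctE /GRing.scale/= !exprS.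
by move: n.+1%:R => u; ring.
Qed.

Lemma Gamma_primitive0 n : Gamma_primitive n 0 = - n`!%:R.
Proof.
elim: n => [|n ih] /=; rewrite !fctE /= ?oppr0 ?expR0// /GRing.scale/=.
by rewrite ih expr0n/= mul0r oppr0 add0r mulrN factS natrM.
Qed.

(** From exp(x) >= 1 + x^(n+1)/(n+1)! one gets x^n exp(-x) <= (n+1)!/x for x > 0. *)
Lemma cvg_exprn_expRN n : (x ^+ n * expR (- x)) @[x --> +oo] --> (0 : R).
Proof.
apply: (@squeeze_cvgr _ _ _ _ (cst 0) (fun x => n.+1`!%:R * x^-1)).
- near=> x; have x0 : 0 < x by near: x; exact: nbhs_pinfty_gt.
  apply/andP; split; first by rewrite mulr_ge0 ?expR_ge0// exprn_ge0// ltW.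
  rewrite expRN ler_pdivrMr ?expR_gt0// mulrAC ler_pdivlMr// -exprSr.
  rewrite -ler_pdivrMl ?ltr0n ?fact_gt0// mulrC.
  by apply: le_trans (expR_ge1Dxn n (ltW x0)); rewrite lerDr.
- exact: cvg_cst.
- rewrite -[X in _ --> X](mulr0 (n.+1`!%:R)); apply: cvgM; first exact: cvg_cst.
  apply/(@gtr0_cvgV0 _ _ _ _ (id : R -> R)); last exact: cvg_id.
  exact: nbhs_pinfty_gt.
Unshelve. all: by end_near. Qed.

Lemma cvg_Gamma_primitive n : Gamma_primitive n x @[x --> +oo] --> (0 : R).
Proof.
elim: n => [|n ih].
  rewrite -oppr0; apply: cvgN.
  exact: cvgr_expR.
rewrite (_ : Gamma_primitive n.+1 = (fun x => - (x ^+ n.+1 * expR (- x)) +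
  n.+1%:R * Gamma_primitive n x)); last by rewrite /= !fctE.
rewrite -[X in _ --> X]addr0; apply: cvgD.
  by rewrite -oppr0; apply: cvgN; exact: cvg_exprn_expRN.
by rewrite -(mulr0 n.+1%:R); apply: cvgM; first exact: cvg_cst.
Qed.

Lemma Gamma_natS n : Gamma n.+1%:R = n`!%:R :> R.
Proof.
rewrite /Gamma.
transitivity (\int[lebesgue_measure]_(x in `]0, +oo[) (x ^+ n * expR (- x)) : R).
  apply: eq_Rintegral => x; rewrite inE/= in_itv/= andbT => x0.
  by rewrite -natr1 addrK powR_mulrn// ltW.
have cf : continuous (fun x : R => x ^+ n * expR (- x)).
  move=> x; apply: cvgM; first exact: exprn_continuous.
  apply: (@continuous_comp _ _ _ -%R expR); first exact: opp_continuous.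
  exact: continuous_expR.
(* The endpoint 0 is added to the domain, so that the fundamental theorem applies on the half-line
   closed at 0. *)
rewrite /Rintegral integral_itv_obnd_cbnd; last first.
  by apply/measurable_EFinP/measurable_funTS; exact: continuous_measurable_fun.
rewrite (@ge0_continuous_FTC2y _ _ (Gamma_primitive n) _ 0).
- by rewrite Gamma_primitive0 -EFinB sub0r opprK.
- by move=> x x0; rewrite mulr_ge0 ?exprn_ge0 ?expR_ge0.
- exact: continuous_subspaceT.
- exact: cvg_Gamma_primitive.
- by move=> x _; have [] := is_derive_Gamma_primitive n x.
- apply: cvg_at_right_filter.
  exact: is_derive_continuous (is_derive_Gamma_primitive n 0).
- by move=> x _; rewrite derive1E; have [] := is_derive_Gamma_primitive n x.
Qed.

End primitives.

(** * The Dirichlet integral *)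

Section dirichlet_integral.
Context {R : realType}.

Definition corner n (t : R) : set (n.-tuple R) :=
  [set x | (forall i, 0 <= tnth x i) /\ \sum_i tnth x i <= t].

(** With the indicator inside the integrand, integrals run over all of R^n and Tonelli needs no
    varying domain. The size [t] is a parameter because it shrinks as coordinates are integrated
    out. *)
Definition dirichlet_kernel n (a : 'I_n -> nat) (b : nat) (t : R) (x : n.-tuple R) : R :=
  \1_(@corner n t) x * ((\prod_i tnth x i ^+ a i) * (t - \sum_i tnth x i) ^+ b).

Lemma measurable_sum_tnth n : measurable_fun setT (fun x : n.-tuple R => \sum_i tnth x i).
Proof. by apply: measurable_sum => i; exact: measurable_tnth. Qed.

Lemma measurable_corner n t : measurable (@corner n t).
Proof.
rewrite (_ : @corner n t = box (fun=> `[0, +oo[%classic) `&`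
    ((fun x : n.-tuple R => \sum_i tnth x i) @^-1` `]-oo, t]%classic)).
  apply: measurableI; first by apply: measurable_box => i; exact: measurable_itv.
  by rewrite -[X in measurable X]setTI; exact: measurable_sum_tnth.
apply/seteqP; split => x [x0 xt]; split.
- by move=> i /=; rewrite in_itv/= x0.
- by rewrite /= in_itv.
- by move=> i; have := x0 i; rewrite /= in_itv/= andbT.
- by move: xt; rewrite /= in_itv.
Qed.

Lemma measurable_dirichlet_kernel n (a : 'I_n -> nat) b t :
  measurable_fun setT (dirichlet_kernel a b t).
Proof.
apply: measurable_funM.
  exact: (measurable_indic (@measurable_corner n t)).
apply: measurable_funM.
  by apply: measurable_prod => i _; apply: measurable_funX; exact: measurable_tnth.
by apply: measurable_funX; apply: measurable_funB => //; exact: measurable_sum_tnth.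
Qed.

Lemma dirichlet_kernel_ge0 n (a : 'I_n -> nat) b t x : 0 <= dirichlet_kernel a b t x.
Proof.
rewrite /dirichlet_kernel indicE; have [|] := boolP (x \in _); last by rewrite mul0r.
rewrite inE => -[x0 xt]; rewrite mul1r mulr_ge0//.
  by apply: prodr_ge0 => i _; rewrite exprn_ge0.
by rewrite exprn_ge0// subr_ge0.
Qed.

(** (z, x) lies in the corner of size t exactly when z is in [0, t] and x is in the corner of size t
    - z. *)
Lemma dirichlet_kernel_tcons n (a : 'I_n.+1 -> nat) b t z (x : n.-tuple R) :
  dirichlet_kernel a b t (tcons (z, x)) =
  \1_(`[0, t]%classic) z * (z ^+ a ord0 * dirichlet_kernel (a \o lift ord0) b (t - z) x).
Proof.
rewrite /dirichlet_kernel !big_ord_recl/=.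
have e i : tnth (tcons (z, x)) (lift ord0 i) = tnth x i by rewrite tnthS.
have e0 : tnth (tcons (z, x)) ord0 = z by rewrite tnth0.
rewrite e0 (eq_bigr (fun i => tnth x i ^+ a (lift ord0 i))); last first.
  by move=> i _; rewrite e.
rewrite [\sum_(i < n) _](eq_bigr (fun i => tnth x i)); last by move=> i _; rewrite e.
rewrite opprD addrA.
rewrite [\1_(@corner n.+1 t) _](_ : _ = \1_(`[0, t]%classic) z * \1_(@corner n (t - z)) x).
  by ring.
rewrite -[RHS]natrM mulnb !indicE; congr (_ %:R); congr nat_of_bool.
apply/idP/andP.
  rewrite inE => -[zx0 zxt]; rewrite !inE/= in_itv/=.
  have z0 : 0 <= z by rewrite -e0.
  have x0 i : 0 <= tnth x i by rewrite -e.
  move: zxt; rewrite big_ord_recl e0; under eq_bigr do rewrite e.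
  have : 0 <= \sum_i tnth x i by apply: sumr_ge0.
  rewrite z0/= => s0 zxt.
  split; [lra|split => //].
  by lra.
rewrite !inE/= in_itv/= => -[/andP[z0 zt] [x0 xt]]; split.
  by move=> i; case: (unliftP ord0 i) => [j|] ->; rewrite ?e ?e0.
rewrite big_ord_recl e0; under eq_bigr do rewrite e.
by lra.
Qed.

Local Open Scope ereal_scope.

(** By induction on [n]: Tonelli isolates the first coordinate z, the induction hypothesis evaluates
    the inner integral, and a Beta integral in z remains. *)
Lemma integral_dirichlet_kernel n (a : 'I_n -> nat) b (t : R) : (0 <= t)%R ->
  \int[lebesgue_tuple R n]_x (dirichlet_kernel a b t x)%:E =
  ((\prod_i (a i)`! * b`!)%:R / (\sum_i a i + n + b)`!%:R *
    t ^+ (\sum_i a i + n + b))%:E.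
Proof.
elim: n a b t => [|n ih] a b t t0.
  rewrite integral_dirac//; last first.
    by apply/measurable_EFinP; exact: measurable_dirichlet_kernel.
  rewrite diracT mul1e /dirichlet_kernel !big_ord0 subr0 indicE mem_set; last first.
    by split; [case|rewrite big_ord0].
  by rewrite mul1n divff ?pnatr_eq0 -?lt0n ?fact_gt0// !mul1r.
have mk m (a' : 'I_m -> nat) t' : measurable_fun setT (fun x => (dirichlet_kernel a' b t' x)%:E).
  by apply/measurable_EFinP; exact: measurable_dirichlet_kernel.
transitivity (\int[pushforward (@lebesgue_measure R \x lebesgue_tuple R n) (@tcons R n)]_x
    (dirichlet_kernel a b t x)%:E) => //.
rewrite (ge0_integral_pushforward (@measurable_tcons R n))//; last first.
  by move=> x _; rewrite lee_fin dirichlet_kernel_ge0.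
  exact: mk.
rewrite preimage_setT fubini_tonelli1; last 2 first.
- exact: measurableT_comp (mk _ _ _) (@measurable_tcons R n).
- by move=> x; rewrite lee_fin dirichlet_kernel_ge0.
(* [N] is the exponent of t - z, and [c] the constant, that the induction hypothesis yields for the
   inner integral. *)
pose N := (\sum_i a (lift ord0 i) + n + b)%N.
pose c : R := ((\prod_i (a (lift ord0 i))`! * b`!)%:R / N`!%:R)%R.
transitivity (\int[lebesgue_measure]_(z in `[0%R, t])
    (c%:E * (z ^+ a ord0 * (t - z) ^+ N)%:E)).
  rewrite [RHS]integral_mkcond; apply: eq_integral => z _.
  rewrite /fubini_F patchE.
  transitivity (\int[lebesgue_tuple R n]_x ((\1_(`[0%R, t]%classic) z * z ^+ a ord0)%:E *
     (dirichlet_kernel (a \o lift ord0) b (t - z) x)%:E)).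
    apply: eq_integral => x _ /=.
    by rewrite dirichlet_kernel_tcons -EFinM mulrA.
  rewrite indicE; case: ifPn => zt; last first.
    by rewrite mul0r; under eq_integral do rewrite mul0e; rewrite integral0.
  have /andP[z0 tz] : (0 <= z <= t)%R by move: zt; rewrite inE/= in_itv.
  rewrite mul1r ge0_integralZl_EFin//; last 3 first.
  - by move=> x _; rewrite lee_fin dirichlet_kernel_ge0.
  - exact: mk.
  - by rewrite exprn_ge0.
  by rewrite ih ?subr_ge0// -!EFinM; congr (_%:E); rewrite -/N -/c mulrCA.
rewrite ge0_integralZl_EFin//; last 3 first.
- move=> z; rewrite /= in_itv/= => /andP[z0 zt].
  by rewrite lee_fin mulr_ge0// exprn_ge0// subr_ge0.
- apply/measurable_EFinP; apply: measurable_funTS.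
  by apply: continuous_measurable_fun; exact: continuous_beta_kernel.
- by rewrite divr_ge0.
rewrite integral_beta_kernel// -EFinM; congr (_%:E).
rewrite !big_ord_recl (_ : (_ + _ + n.+1 + b)%N = (a ord0 + N).+1); last first.
  by rewrite /N addnS addSn !addnA.
rewrite mulrA; congr (_ * _)%R; rewrite /c (natrM _ (a ord0)`! N`!).
have : (N`!%:R != 0 :> R)%R by rewrite pnatr_eq0 -lt0n fact_gt0.
have : ((a ord0 + N).+1`!%:R != 0 :> R)%R by rewrite pnatr_eq0 -lt0n fact_gt0.
move: ((a ord0 + N).+1`!%:R : R)%R (N`!%:R : R)%R => u v u0 v0; rewrite !natrM.
by field; rewrite ?u0 ?v0.
Qed.

End dirichlet_integral.

(** * The Dirichlet distribution *)

Section dirichlet_monomial.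
Context {R : realType} (d : nat) (a : 'I_d.+1 -> nat).
Local Open Scope ereal_scope.
Local Notation chart := (@simplex_chart R d).

Definition monomial (p : d.+1.-tuple R) : R := (\prod_k tnth p k ^+ a k)%R.

Definition monomial_mass (A : set (d.+1.-tuple R)) : \bar R :=
  \int[lebesgue_tuple R d]_(x in chart @^-1` (simplex R d `&` A))
    (monomial (chart x))%:E.

Lemma measurable_simplex : measurable (simplex R d).
Proof.
rewrite (_ : simplex R d = box (fun=> `[0%R, +oo[%classic) `&` @hyper R d).
  apply: measurableI; last exact: measurable_hyper.
  by apply: measurable_box => i; exact: measurable_itv.
by apply/seteqP; split => x [x0 x1]; split => // i; have := x0 i; rewrite /= in_itv/= andbT.
Qed.

Lemma measurable_preimage_chart A : measurable A -> measurable (chart @^-1` A).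
Proof. by move=> mA; rewrite -[X in measurable X]setTI; exact: measurable_chart. Qed.

Lemma measurable_preimage_simplex A : measurable A ->
  measurable (chart @^-1` (simplex R d `&` A)).
Proof.
move=> mA; apply: measurable_preimage_chart; apply: measurableI => //.
exact: measurable_simplex.
Qed.

Lemma measurable_monomial : measurable_fun setT monomial.
Proof.
rewrite /monomial; apply: measurable_prod => k _.
by apply: measurable_funX; exact: measurable_tnth.
Qed.

Lemma measurable_monomial_chart : measurable_fun setT (monomial \o chart).
Proof. exact: measurableT_comp measurable_monomial measurable_chart. Qed.

Lemma monomial_ge0 p : simplex R d p -> (0 <= monomial p)%R.
Proof. by move=> [p0 _]; apply: prodr_ge0 => k _; rewrite exprn_ge0. Qed.

Lemma integral_monomialZ A (c : R) : measurable A -> (0 <= c)%R ->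
  \int[lebesgue_tuple R d]_(x in chart @^-1` (simplex R d `&` A))
    (c * monomial (chart x))%:E = c%:E * monomial_mass A.
Proof.
move=> mA c0; under eq_integral do rewrite EFinM.
rewrite ge0_integralZl_EFin//.
- exact: measurable_preimage_simplex.
- by move=> x [sx _]; rewrite lee_fin monomial_ge0.
- by apply/measurable_EFinP/measurable_funTS; exact: measurable_monomial_chart.
Qed.

(** In the chart the simplex is the corner of size 1, and the last coordinate 1 - sum x supplies the
    factor with exponent [b = a ord_max]. *)
Lemma monomial_mass_setT :
  monomial_mass setT = ((\prod_k (a k)`!)%:R / (\sum_k (a k).+1).-1`!%:R)%:E.
Proof.
rewrite /monomial_mass setIT integral_mkcond.
transitivity (\int[lebesgue_tuple R d]_x (dirichlet_kernel
    (fun i => a (widen_ord (leqnSn d) i)) (a ord_max) 1 x)%:E).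
  apply: eq_integral => x _; rewrite patchE /dirichlet_kernel indicE.
  have -> : (x \in chart @^-1` simplex R d) = (x \in @corner R d 1).
    apply/idP/idP; rewrite !inE => -[].
      move=> x0 _; split=> [i|]; first by rewrite -tnth_chart.
      by have := x0 ord_max; rewrite tnth_chart_max subr_ge0.
    move=> x0 x1; split; last exact: hyper_chart.
    move=> k; have [->|kd] := eqVneq k ord_max.
      by rewrite tnth_chart_max subr_ge0.
    have kd' : (k < d)%N by rewrite ltn_neqAle -ltnS ltn_ord andbT.
    rewrite (_ : k = widen_ord (leqnSn d) (Ordinal kd')); last exact: val_inj.
    by rewrite tnth_chart.
  case: ifPn => _; last by rewrite mul0r.
  rewrite mul1r /monomial big_ord_recr/= tnth_chart_max.
  by under eq_bigr do rewrite tnth_chart.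
rewrite integral_dirichlet_kernel// expr1n mulr1 big_ord_recr/=.
congr ((_ / _ `!%:R)%:E).
(* Both factorials are of the sum of all [a k] plus [d]: there are [d + 1] successors and one
   predecessor. *)
rewrite big_ord_recr/= addnS/=.
rewrite [in RHS](eq_bigr (fun i : 'I_d => a (widen_ord (leqnSn d) i) + 1)%N).
  by rewrite big_split/= sum_nat_const card_ord muln1.
by move=> i _; rewrite addn1.
Qed.

Variable c : R.
Hypothesis c0 : (0 <= c)%R.
Hypothesis c1 : (c * ((\prod_k (a k)`!)%:R / (\sum_k (a k).+1).-1`!%:R) = 1)%R.

Definition monomial_prob (A : set (d.+1.-tuple R)) : \bar R :=
  \int[lebesgue_tuple R d]_(x in chart @^-1` (simplex R d `&` A))
    (c * monomial (chart x))%:E.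

Let monomial_prob0 : monomial_prob set0 = 0.
Proof. by rewrite /monomial_prob setI0 preimage_set0 integral_set0. Qed.

Let monomial_prob_ge0 A : 0 <= monomial_prob A.
Proof.
by apply: integral_ge0 => x [sx _]; rewrite lee_fin mulr_ge0// monomial_ge0.
Qed.

Let monomial_prob_sigma_additive : semi_sigma_additive monomial_prob.
Proof.
move=> /= F mF tF mUF; rewrite /monomial_prob; apply: cvg_toP.
  apply: ereal_nondecreasing_is_cvgn => m n mn.
  by apply: lee_sum_nneg_natr => // k _ _; exact: monomial_prob_ge0.
rewrite setI_bigcupr preimage_bigcup ge0_integral_bigcup//=.
- by move=> k; exact: measurable_preimage_simplex.
- apply/measurable_EFinP/measurable_funTS; apply: measurable_funM => //.
  exact: measurable_monomial_chart.
- by move=> x [k _ [sx _]]; rewrite lee_fin mulr_ge0// monomial_ge0.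
- apply/trivIsetP => i j _ _ ij; rewrite -preimage_setI -setIIr.
  move/trivIsetP : tF => /(_ i j Logic.I Logic.I ij) ->.
  by rewrite setI0 preimage_set0.
Qed.

HB.instance Definition _ := isMeasure.Build _ _ _ monomial_prob
  monomial_prob0 monomial_prob_ge0 monomial_prob_sigma_additive.

Let monomial_prob_setT : monomial_prob setT = 1.
Proof.
by rewrite /monomial_prob integral_monomialZ// monomial_mass_setT -EFinM c1.
Qed.

HB.instance Definition _ := Measure_isProbability.Build _ _ _ monomial_prob
  monomial_prob_setT.

Lemma exists_monomial_prob : exists P : probability (d.+1.-tuple R) R,
  forall A, measurable A -> P A = c%:E * monomial_mass A.
Proof.
exists (monomial_prob : probability (d.+1.-tuple R) R) => A mA.
exact: integral_monomialZ.
Qed.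

End dirichlet_monomial.

(** * Both densities as multiples of one monomial *)

Section hausdorff_density.
Context {R : realType} (d : nat).
Local Open Scope ereal_scope.
Local Notation chart := (@simplex_chart R d).

(** On Borel subsets of the simplex the Hausdorff measure is the push-forward by the chart of [K]
    times Lebesgue measure; the formula is then a change of variables. *)
Lemma integral_hausdorff_chart (K : R) (A : set (d.+1.-tuple R)) (f : d.+1.-tuple R -> R) :
  (0 < K)%R ->
  (forall B, measurable B ->
    hausdorff d (B `&` @hyper R d) = K%:E * lebesgue_tuple R d (chart @^-1` B)) ->
  measurable A -> A `<=` simplex R d -> measurable_fun setT f ->
  (forall p, A p -> 0 <= f p)%R ->
  \int[@hausdorff R d.+1 d]_(p in A) (f p)%:E =
  K%:E * \int[lebesgue_tuple R d]_(x in chart @^-1` A) (f (chart x))%:E.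
Proof.
move=> K0 HK mA AS mf f0.
have mEf D : measurable_fun D (fun p => (f p)%:E).
  by apply/measurable_EFinP/measurable_funTS.
have f0E p : A p -> 0 <= (f p)%:E by move=> /f0; rewrite lee_fin.
pose KL := mscale (NngNum (ltW K0)) (lebesgue_tuple R d).
transitivity (\int[pushforward KL chart]_(p in A) (f p)%:E).
  apply: (@eq_measure_integral _ _ _ _ (pushforward KL chart)) => [|? B mB BA].
    exact: measurable_chart.
  transitivity (hausdorff d (B `&` @hyper R d)); last exact: HK.
  by congr (hausdorff d _); apply/esym/setIidPl => p /BA /AS [].
rewrite (ge0_integral_pushforward (@measurable_chart R d))//; last first.
  by move=> p; rewrite inE => /f0E.
rewrite ge0_integral_mscale//=.
- exact: measurable_preimage_chart.
- apply/measurable_EFinP/measurable_funTS.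
  exact: measurableT_comp mf (@measurable_chart R d).
- by move=> x /f0E.
Qed.

Lemma ldensE (p : d.+1.-tuple R) :
  ldens p = ((\prod_(k < d.+1) (nexp d k)`!)%:R^-1 * monomial (fun k : 'I_d.+1 => nexp d k) p)%R.
Proof. by rewrite /ldens big_split/= prodfV -natr_prod mulrC. Qed.

(** For k <= d the binomial coefficient is positive, so the truncated subtraction in [nexp] loses
    nothing. *)
Lemma binS_nexp (k : 'I_d.+1) : 'C(d, k) = (nexp d k).+1.
Proof. by rewrite /nexp subn1 prednK// bin_gt0 -ltnS. Qed.

Lemma dirichlet_pdfE (p : d.+1.-tuple R) : simplex R d p ->
  dirichlet_pdf (fun k : 'I_d.+1 => 'C(d, k)%:R) p =
  ((\sum_(k < d.+1) (nexp d k).+1).-1`!%:R / (\prod_(k < d.+1) (nexp d k)`!)%:R *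
   monomial (fun k : 'I_d.+1 => nexp d k) p)%R.
Proof.
move=> [p0 _]; rewrite /dirichlet_pdf /monomial; congr (_ / _ * _)%R.
- rewrite -natr_sum (eq_bigr (fun k : 'I_d.+1 => (nexp d k).+1)); last first.
    by move=> k _; exact: binS_nexp.
  rewrite -[X in Gamma X%:R](@prednK) ?Gamma_natS//.
  by rewrite big_ord_recl addSn.
- rewrite natr_prod; apply: eq_bigr => k _.
  by rewrite binS_nexp Gamma_natS.
(* Real and integer powers agree at nonnegative coordinates, including 0^0 = 1. *)
- apply: eq_bigr => k _; rewrite binS_nexp -natr1 addrK powR_mulrn//.
Qed.

End hausdorff_density.

Theorem proposition3p1 (R : realType) (d : nat) (hd : (1 <= d)%N) :
  (exists P : probability (d.+1.-tuple R) R,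
     has_density_proportional_to (@hausdorff R d.+1 d) (simplex R d)
       (@ldens R d) P)
  /\
  (forall P : probability (d.+1.-tuple R) R,
     has_density_proportional_to (@hausdorff R d.+1 d) (simplex R d)
       (@ldens R d) P
     <->
     is_dirichlet (fun k : 'I_d.+1 => 'C(d, k)%:R) P).
Proof.
pose a (k : 'I_d.+1) := nexp d k.
(* [F / N] is the value of the Dirichlet integral of the monomial. *)
pose F : R := (\prod_k (a k)`!)%:R; pose N : R := (\sum_k (a k).+1).-1`!%:R.
have F0 : 0 < F by rewrite ltr0n; apply: prodn_gt0 => k; exact: fact_gt0.
have N0 : 0 < N by rewrite ltr0n fact_gt0.
have [K K0 HK] := @hausdorff_hyper R d.
have densE c A : 0 < c -> measurable A ->
    (\int[@hausdorff R d.+1 d]_(p in simplex R d `&` A) (c * ldens p)%:E =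
     (K * c / F)%:E * monomial_mass a A)%E.
  move=> c0 mA; have cF0 : 0 <= c / F by rewrite divr_ge0// ltW.
  rewrite (eq_integral (fun p => (c / F * monomial a p)%:E)); last first.
    by move=> p _; rewrite ldensE mulrA.
  rewrite (integral_hausdorff_chart K0 HK).
  - by rewrite integral_monomialZ// muleA -EFinM mulrA.
  - by apply: measurableI => //; exact: measurable_simplex.
  - exact: subIsetl.
  - by apply: measurable_funM => //; exact: measurable_monomial.
  - by move=> p [sp _]; rewrite mulr_ge0// monomial_ge0.
have dirE A : measurable A ->
    (\int[lebesgue_tuple R d]_(x in [set x : d.-tuple R | (simplex R d `&` A) (simplex_chart x)])
      (dirichlet_pdf (fun k : 'I_d.+1 => 'C(d, k)%:R) (simplex_chart x))%:E =
     (N / F)%:E * monomial_mass a A)%E.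
  move=> mA; rewrite -integral_monomialZ//; last by rewrite divr_ge0// ltW.
  by apply: eq_integral => x; rewrite inE => -[sx _]; rewrite dirichlet_pdfE.
have iff_dir P : has_density_proportional_to (@hausdorff R d.+1 d) (simplex R d)
    (@ldens R d) P <-> is_dirichlet (fun k : 'I_d.+1 => 'C(d, k)%:R) P.
  split=> [[c c0 Pc] A mA|Pdir].
    rewrite Pc// densE// dirE//; congr (_%:E * _)%E.
    (* Total mass 1 reads (K c / F) (F / N) = 1, which forces the two constants to agree. *)
    have := Pc setT measurableT; rewrite densE// probability_setT monomial_mass_setT.
    rewrite -EFinM => -[] E1; apply: (@mulIf _ (F / N)).
      by rewrite mulf_neq0 ?invr_eq0 ?gt_eqF.
    transitivity (1 : R); first exact/esym/E1.
    by field; rewrite !gt_eqF.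
  (* The constant c solving K c / F = N / F. *)
  exists (N / K); first by rewrite divr_gt0.
  move=> A mA; rewrite Pdir// dirE// densE ?divr_gt0//; congr (_%:E * _)%E.
  by field; rewrite !gt_eqF.
split=> //.
(* Existence is obtained on the Dirichlet side, where [N / F] is the normalizing constant, and
   transferred by the equivalence. *)
have [P PE] : exists P : probability (d.+1.-tuple R) R,
    forall A, measurable A -> P A = ((N / F)%:E * monomial_mass a A)%E.
  apply: exists_monomial_prob; first by rewrite divr_ge0// ltW.
  change (N / F * (F / N) = 1).
  by rewrite mulrA divfK ?divff// gt_eqF.
by exists P; apply/iff_dir => A mA; rewrite PE// dirE.
Qed.
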